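(* Let $\rho\in[0,1]$ and let $(Z,Y)$ be a bivariate normal random vector with mean $0$ and covariance matrix $\begin{pmatrix}1&\rho\\ \rho&1\end{pmatrix}$. Let $k,l\in\mathbb{N}$, let $-\infty=a_0<a_1<\dots<a_k<a_{k+1}=\infty$ and $-\infty=b_0<b_1<\dots<b_l<b_{l+1}=\infty$, and let $f,g\colon\mathbb{R}\to\mathbb{R}$ satisfy (i) $f,g$ are both increasing or both decreasing; (ii) $f$ is Lipschitz continuous on the interval $(a_{i-1},a_i)$ for all $i\in\{1,\dots,k+1\}$, and $g$ is Lipschitz continuous on the interval $(b_{j-1},b_j)$ for all $j\in\{1,\dots,l+1\}$. Then $$\mathbb{E}[f(Z)g(Y)]-\mathbb{E}[f(Z)]\,\mathbb{E}[g(Y)]\ \ge\ \sum_{i=1}^k\sum_{j=1}^l (f(a_i+)-f(a_i-))\,(g(b_j+)-g(b_j-))\,\frac{1}{2\pi}\,e^{-\frac{a_i^2}{2}}\int_0^{\rho}\frac{1}{\sqrt{1-u^2}}\,e^{-\frac{(b_j-a_iu)^2}{2(1-u^2)}}\,du.$$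
   Context: ''Increasing'' and ''decreasing'' are meant in the weak sense. $f(a-)$ and $f(a+)$ denote the left and right limits of $f$ at $a$ (similarly for $g$); at the points $a_i$ (respectively $b_j$) they exist and are finite by (ii). *)

(* Defs.v *)
From mathcomp Require Import all_boot all_order all_algebra.
From mathcomp Require Import all_classical all_reals all_analysis.

Set Implicit Arguments.
Unset Strict Implicit.
Unset Printing Implicit Defensive.

Import Order.TTheory GRing.Theory Num.Theory.
Import numFieldNormedType.Exports.

Local Open Scope classical_set_scope.
Local Open Scope ring_scope.

(* (X, Y) ~ N(m, S): (X, Y) has the law of m + A *m W, where A *m A^T = S and
   W is a pair of independent standard normal variables, whose law is the
   product measure below. No density is involved, so S may be singular. *)
Definition bivariate_normal (d : measure_display) (T : measurableType d)
    (R : realType) (P : probability T R) (X Y : {RV P >-> R})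
    (m : 'cV[R]_2) (S : 'M[R]_2) : Prop :=
  exists A : 'M[R]_2, A *m A^T = S /\
    forall B : set (R * R), measurable B ->
      P [set t | B (X t, Y t)] =
      (normal_prob (0 : R) 1 \x normal_prob (0 : R) 1)%E
        [set w : R * R | B (m 0 0 + (A 0 0 * w.1 + A 0 1 * w.2),
                            m 1 0 + (A 1 0 * w.1 + A 1 1 * w.2))].

(* The extended sequence -oo = a_0, a_1, ..., a_n, a_(n.+1) = +oo; only the
   values a 1, ..., a n of the function a are used. *)
Definition knot (R : realType) (n : nat) (a : nat -> R) (i : nat) : \bar R :=
  if (i == 0)%N then -oo%E else if (i <= n)%N then (a i)%:E else +oo%E.

Definition piecewise_lipschitz (R : realType) (n : nat) (a : nat -> R)
    (f : R -> R) : Prop :=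
  forall i : nat, (i <= n)%N ->
    [lipschitz f x | x in [set x : R | (knot n a i < x%:E < knot n a i.+1)%E]].

Definition jump (R : realType) (f : R -> R) (x : R) : R :=
  lim (f @ x^'+) - lim (f @ x^'-).

(* Main.v *)
Require Import Defs.
From mathcomp Require Import all_boot all_order all_algebra.
From mathcomp Require Import all_classical all_reals all_analysis.
From mathcomp Require Import measurable_realfun.
From mathcomp Require Import ring lra.
Set Implicit Arguments.
Unset Strict Implicit.
Unset Printing Implicit Defensive.
Import Order.TTheory GRing.Theory Num.Theory.
Import numFieldNormedType.Exports.
Local Open Scope classical_set_scope.
Local Open Scope ring_scope.

(* The proof splits off the jumps. Write f = f0 + sum_i f_i, where f_i is the
   step function carrying the jump of f at a_i; f0 is still monotone, and
   likewise for g = g0 + sum_j g_j. Monotone functions of Z and Y are nonnegatively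
   correlated: conditionally on Z, E[g(Y) | Z] is a monotone function of Z
   because rho >= 0, so Chebyshev's association inequality applies. Hence
   Cov(f, g) >= sum_i Cov(f_i, g) >= sum_ij Cov(f_i, g_j), and the covariances of
   step functions reduce to those of indicators of half-lines.

   For these, Plackett's identity
     P(Z > a, Y > b) = P(Z > a) P(Y > b) + int_0^rho p_u(a, b) du,
   with p_u the bivariate normal density of correlation u, is obtained from
   Tonelli's theorem applied to phi(z) phi(v) |dv/du| with
   v = (b - u z) / sqrt(1 - u^2): integrating in u gives the mass of the slice of
   the quadrant at z, integrating in z gives p_u(a, b). The kernel is nonnegative
   for z > a >= max(0, b), and every other pair (a, b) is brought to this case by
   exchanging or negating the two variables. *)

(** The matrix [A] in [bivariate_normal] is arbitrary. Rotation invariance of the Gaussian plane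
    shows that the law of (Z, Y) depends on S alone, so [A] may be taken triangular: conditioning on
    Z is then integration in one coordinate, and rho = 1 needs no density. Plackett's identity is
    classically the integrated form of d P(Z > a, Y > b) / d rho = p_rho(a, b). Substituting in u on
    each slice avoids differentiation under the integral sign. The price is a sign condition on
    dv/du, needed for Tonelli, and it dictates the region z > a >= max(0, b). Outside this region
    and at rho = 1 only an inequality is kept: negation exchanges open and closed half-lines, and
    the integrand may blow up at u = 1. This is enough, since each covariance is only bounded from
    below and its weight, a product of two jumps, is nonnegative. Lipschitz continuity on the
    unbounded pieces gives f and g linear growth, hence integrability. *)

(** The change of variables holds with the Radon-Nikodym derivative, which agrees with [normal_pdf]
    almost everywhere because both have the same integral over every measurable set. *)
Lemma ge0_integral_normal_prob (R : realType) (m s : R) (D : set R)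
    (f : R -> \bar R) :
  measurable D -> (forall x, (0 <= f x)%E) -> measurable_fun D f ->
  (\int[normal_prob m s]_(x in D) f x =
   \int[lebesgue_measure]_(x in D) (f x * (normal_pdf m s x)%:E))%E.
Proof.
move=> mD f0 mf.
have dom := normal_prob_dominates m s.
rewrite -(Radon_Nikodym_SigmaFinite.change_of_variables dom)//.
have irn := Radon_Nikodym_SigmaFinite.f_integrable dom.
have mp : measurable_fun setT (fun x => (normal_pdf m s x)%:E).
  by apply/measurable_EFinP; exact: measurable_normal_pdf.
apply: ge0_ae_eq_integral => //.
- apply: emeasurable_funM => //; apply/measurable_funTS.
  exact: (measurable_int _ irn).
- by apply: emeasurable_funM => //; exact/measurable_funTS.
- by move=> x _; rewrite mule_ge0// Radon_Nikodym_SigmaFinite.f_ge0.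
- by move=> x _; rewrite mule_ge0// lee_fin normal_pdf_ge0.
- apply: ae_eqe_mul2l; apply: integral_ae_eq => //.
  + exact: integrableS irn.
  + exact: measurable_funTS.
  + by move=> E ED mE; rewrite -Radon_Nikodym_SigmaFinite.f_integral.
Qed.

(** * Lebesgue integrals under translation and reflection *)

Section lebesgue_translation.
Context {R : realType}.
Local Notation mu := (@lebesgue_measure R).
Implicit Types (c : R) (K : R -> \bar R).

Lemma lebesgue_measure_shift c (A : set R) : measurable A ->
  pushforward mu ((fun x => x + c) : measurableTypeR R -> measurableTypeR R) A = mu A.
Proof.
move=> mA.
apply/esym/lebesgue_measure_unique => //=.
  exact: measurable_funD.
move=> _ _ [[a b]] _ <- /=.
rewrite /pushforward.
have -> : (fun x => x + c) @^-1` `]a, b] = `]a - c, b - c]%classic.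
  by apply/seteqP; split => x /=; rewrite !in_itv/= ltrBlDr lerBrDr.
rewrite !lebesgue_measure_itv/= !lte_fin ltrD2r.
by case: ifP => // _; rewrite -!EFinB; congr EFin; ring.
Qed.

Lemma ge0_integral_shift c K : measurable_fun setT K -> (forall x, (0 <= K x)%E) ->
  (\int[mu]_x K (x + c)%R = \int[mu]_x K x)%E.
Proof.
move=> mK K0.
have mphi : measurable_fun setT ((fun x => x + c) : measurableTypeR R -> measurableTypeR R).
  exact: measurable_funD.
rewrite -[RHS](_ : \int[pushforward mu ((fun x => x + c)%R : measurableTypeR R -> measurableTypeR R)]_x K x = _)%E.
  by rewrite ge0_integral_pushforward.
by apply: eq_measure_integral => A mA _; exact: lebesgue_measure_shift.
Qed.

Lemma ge0_integral_opp K : measurable_fun setT K -> (forall x, (0 <= K x)%E) ->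
  (\int[mu]_x K (- x)%R = \int[mu]_x K x)%E.
Proof.
move=> mK K0.
rewrite -[RHS](_ : \int[pushforward mu (-%R : measurableTypeR R -> measurableTypeR R)]_x K x = _)%E.
  by rewrite ge0_integral_pushforward.
by apply: eq_measure_integral => A mA _; exact: lebesgue_measureN.
Qed.
End lebesgue_translation.

(** * Rotation invariance of the standard Gaussian measure of the plane *)

Section gaussian_plane.
Context {R : realType}.
Local Notation mu := (@lebesgue_measure R).
Local Notation gamma := (normal_prob (0 : R) 1).
Local Notation gamma2 := (gamma \x gamma)%E.
Local Notation phi := (normal_pdf (0 : R) 1).
Implicit Types (K : R * R -> \bar R) (B : set (R * R)).

Lemma iterated_integral_shear1 (t : R) K : measurable_fun setT K ->
  (forall w, (0 <= K w)%E) ->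
  (\int[mu]_x \int[mu]_y K (x + t * y, y)%R = \int[mu]_x \int[mu]_y K (x, y))%E.
Proof.
move=> mK K0.
have mK1 : measurable_fun setT (fun w : R * R => K (w.1 + t * w.2, w.2)%R).
  apply: (measurableT_comp mK); apply: measurable_fun_pair => //.
  by apply: measurable_funD => //; apply: measurable_funM.
have := @fubini_tonelli _ _ _ _ _ mu mu _ mK1 (fun w => K0 _).
move=> /= ->.
have /= -> := @fubini_tonelli _ _ _ _ _ mu mu _ mK K0.
apply: eq_integral => y _.
rewrite (ge0_integral_shift (t * y) (K := fun x => K (x, y)))//.
apply: (measurableT_comp mK); exact: measurable_fun_pair.
Qed.

Lemma iterated_integral_shear2 (t : R) K : measurable_fun setT K ->
  (forall w, (0 <= K w)%E) ->
  (\int[mu]_x \int[mu]_y K (x, y + t * x)%R = \int[mu]_x \int[mu]_y K (x, y))%E.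
Proof.
move=> mK K0; apply: eq_integral => x _.
rewrite (ge0_integral_shift (t * x) (K := fun y => K (x, y)))//.
apply: (measurableT_comp mK); exact: measurable_fun_pair.
Qed.

Lemma iterated_integral_opp2 K : measurable_fun setT K ->
  (forall w, (0 <= K w)%E) ->
  (\int[mu]_x \int[mu]_y K (x, - y)%R = \int[mu]_x \int[mu]_y K (x, y))%E.
Proof.
move=> mK K0; apply: eq_integral => x _.
rewrite (ge0_integral_opp (K := fun y => K (x, y)))//.
apply: (measurableT_comp mK); exact: measurable_fun_pair.
Qed.

Lemma iterated_integral_opp1 K : measurable_fun setT K ->
  (forall w, (0 <= K w)%E) ->
  (\int[mu]_x \int[mu]_y K (- x, y)%R = \int[mu]_x \int[mu]_y K (x, y))%E.
Proof.
move=> mK K0.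
rewrite (ge0_integral_opp (K := fun x => \int[mu]_y K (x, y))%E)//.
- exact: (@measurable_fun_fubini_tonelli_F _ _ _ _ _ mu K mK K0).
- by move=> x; apply: integral_ge0.
Qed.

Definition rot (p q : R) (w : R * R) := (p * w.1 + q * w.2, p * w.2 - q * w.1).

(* A rotation other than a half-turn is a product of three shears, and a shear
   preserves iterated integrals by translation invariance on each line. *)
Lemma iterated_integral_rot (p q : R) K : p ^+ 2 + q ^+ 2 = 1 ->
  measurable_fun setT K -> (forall w, (0 <= K w)%E) ->
  (\int[mu]_x \int[mu]_y K (rot p q (x, y)) = \int[mu]_x \int[mu]_y K (x, y))%E.
Proof.
move=> pq mK K0; have [q0|q0] := eqVneq q 0.
  move: pq; rewrite q0 expr0n/= addr0 => /eqP; rewrite sqrf_eq1 /rot => /orP[]/eqP ->/=.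
    apply: eq_integral => x _; apply: eq_integral => y _.
    by rewrite !mul1r !mul0r addr0 subr0.
  have mK1 : measurable_fun setT (fun w : R * R => K (- w.1, w.2)).
    apply: (measurableT_comp mK); apply: measurable_fun_pair => //.
    exact: measurableT_comp.
  have <- := iterated_integral_opp1 mK K0.
  have /= <- := iterated_integral_opp2 mK1 (fun w => K0 _).
  apply: eq_integral => x _; apply: eq_integral => y _ /=.
  by rewrite !mulN1r !mul0r addr0 subr0.
(* With p = cos x and q = sin x, [t] is tan(x / 2): the rotation is the horizontal shear by [t], the
   vertical one by [- q], and the first one again. *)
pose t := (1 - p) / q.
pose S1 := fun w : R * R => (w.1 + t * w.2, w.2).
pose S2 := fun w : R * R => (w.1, w.2 + (- q) * w.1).
have mS1 : measurable_fun setT S1.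
  apply: measurable_fun_pair => //.
  by apply: measurable_funD => //; apply: measurable_funM.
have mS2 : measurable_fun setT S2.
  apply: measurable_fun_pair => //.
  by apply: measurable_funD => //; apply: measurable_funM.
have h1 : measurable_fun setT (K \o S1) by exact: measurableT_comp.
have h2 : measurable_fun setT ((K \o S1) \o S2) by exact: measurableT_comp.
have <- := iterated_integral_shear1 t mK K0.
have /= <- := iterated_integral_shear2 (- q) h1 (fun w => K0 _).
have /= <- := iterated_integral_shear1 t h2 (fun w => K0 _).
apply: eq_integral => x _; apply: eq_integral => y _.
congr K; rewrite /rot /S1 /S2 /=.
have q2 : q ^+ 2 = 1 - p ^+ 2 by rewrite -pq; ring.
have tq : t * q = 1 - p by rewrite /t divfK.
have e1 : t * (1 + p) = q.
  by apply: (mulIf q0); rewrite mulrAC tq -expr2 q2; ring.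
congr pair.
- transitivity (x * (1 - t * q) + t * y * (1 + (1 - t * q))); last by ring.
  by rewrite tq -[in LHS]e1; ring.
- transitivity (y * (1 - t * q) - q * x); last by ring.
  by rewrite tq; ring.
Qed.

Lemma gamma2E B : measurable B ->
  (gamma2 B = \int[mu]_x \int[mu]_y (\1_B (x, y) * (phi x * phi y))%:E)%E.
Proof.
move=> mB; rewrite /product_measure1/=.
rewrite ge0_integral_normal_prob//=; last first.
  exact: measurable_fun_xsection.
apply: eq_integral => x _.
rewrite [in LHS]/normal_prob/= integral_mkcond/=.
rewrite -ge0_integralZr//=; last 3 first.
- apply/(measurable_restrictT _ _).1 => //; first exact: measurable_xsection.
  by apply/measurable_funTS/measurable_EFinP; exact: measurable_normal_pdf.
- by move=> y _; apply: erestrict_ge0 => z _; rewrite lee_fin normal_pdf_ge0.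
- by rewrite lee_fin normal_pdf_ge0.
apply: eq_integral => y _.
rewrite patchE indicE /= mem_xsection.
case: ifP => _; first by rewrite -EFinM mul1r mulrC.
by rewrite mul0e mul0r.
Qed.

Lemma normal_pdf01E (x : R) :
  phi x = normal_peak 1 * expR (- (x ^+ 2 / 2)).
Proof. by rewrite normal_pdfE ?oner_neq0// /normal_fun subr0 expr1n mulNr. Qed.

Lemma normal_pdf_rot (p q : R) (w : R * R) : p ^+ 2 + q ^+ 2 = 1 ->
  phi (rot p q w).1 * phi (rot p q w).2 = phi w.1 * phi w.2.
Proof.
move=> pq; rewrite !normal_pdf01E /rot/= mulrACA [RHS]mulrACA -!expRD; congr (_ * expR _).
transitivity (- ((p ^+ 2 + q ^+ 2) * (w.1 ^+ 2 + w.2 ^+ 2) / 2)); first by field.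
by rewrite pq; field.
Qed.

Lemma measurable_density B : measurable B ->
  measurable_fun setT (fun w : R * R => (\1_B w * (phi w.1 * phi w.2))%:E).
Proof.
move=> mB; apply/measurable_EFinP; apply: measurable_funM => //.
by apply: measurable_funM; apply: measurableT_comp => //; exact: measurable_normal_pdf.
Qed.

Lemma density_ge0 B w : (0 <= (\1_B w * (phi w.1 * phi w.2))%:E)%E.
Proof. by rewrite lee_fin !mulr_ge0// normal_pdf_ge0. Qed.

Lemma measurable_linear (a b : R) : measurable_fun setT (fun w : R * R => a * w.1 + b * w.2).
Proof. by apply: measurable_funD; apply: measurable_funM. Qed.

Lemma measurable_linear2 (a b c d : R) :
  measurable_fun setT (fun w : R * R => (a * w.1 + b * w.2, c * w.1 + d * w.2)).
Proof. by apply: measurable_fun_pair; exact: measurable_linear. Qed.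

Lemma gamma2_rot (p q : R) B : p ^+ 2 + q ^+ 2 = 1 -> measurable B ->
  gamma2 (rot p q @^-1` B) = gamma2 B.
Proof.
move=> pq mB.
have mr : measurable_fun setT (rot p q).
  rewrite (_ : rot p q = fun w => (p * w.1 + q * w.2, (- q) * w.1 + p * w.2)).
    exact: measurable_linear2.
  by apply/funext => w; rewrite /rot; congr pair; ring.
have mB' : measurable (rot p q @^-1` B).
  by rewrite -[X in measurable X]setTI; exact: mr.
rewrite (gamma2E mB) (gamma2E mB').
have <- := iterated_integral_rot pq (measurable_density mB) (density_ge0 B).
apply: eq_integral => x _; apply: eq_integral => y _.
by congr (_ * _)%:E; exact/esym/(normal_pdf_rot (x, y) pq).
Qed.

Lemma gamma2_opp2 B : measurable B ->
  gamma2 [set w | B (w.1, - w.2)] = gamma2 B.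
Proof.
move=> mB.
have mr : measurable_fun setT (fun w : R * R => (w.1, - w.2)).
  by apply: measurable_fun_pair => //; exact: measurableT_comp.
have mB' : measurable [set w : R * R | B (w.1, - w.2)].
  by rewrite -[X in measurable X]setTI; exact: mr.
rewrite (gamma2E mB) (gamma2E mB').
have <- := iterated_integral_opp2 (measurable_density mB) (density_ge0 B).
apply: eq_integral => x _; apply: eq_integral => y _ /=.
by rewrite !normal_pdf01E sqrrN.
Qed.

(* Up to the reflection w.2 |-> - w.2, the left-hand side is the right-hand side
   precomposed with the rotation sending the unit vector (p, q) to (1, 0). *)
Lemma gamma2_linear (p q r s rho : R) B :
  p ^+ 2 + q ^+ 2 = 1 -> r ^+ 2 + s ^+ 2 = 1 -> p * r + q * s = rho ->
  measurable B ->
  gamma2 [set w | B (p * w.1 + q * w.2, r * w.1 + s * w.2)] =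
  gamma2 [set w | B (w.1, rho * w.1 + Num.sqrt (1 - rho ^+ 2) * w.2)].
Proof.
move=> pq rs prqs mB.
(* The determinant of the two unit vectors. Lagrange's identity gives d^2 = 1 - rho^2, so [d] is the
   required square root up to sign; a negative sign is removed by the reflection. *)
pose d := p * s - q * r.
have d2 : d ^+ 2 = 1 - rho ^+ 2.
  rewrite -prqs /d; transitivity ((p ^+ 2 + q ^+ 2) * (r ^+ 2 + s ^+ 2) - (p * r + q * s) ^+ 2).
    by ring.
  by rewrite pq rs mul1r.
have rE : r = rho * p - d * q.
  by rewrite -prqs /d; transitivity (r * (p ^+ 2 + q ^+ 2)); [rewrite pq mulr1|ring].
have sE : s = rho * q + d * p.
  by rewrite -prqs /d; transitivity (s * (p ^+ 2 + q ^+ 2)); [rewrite pq mulr1|ring].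
set sg := Num.sqrt _.
have mB' (e : R) : measurable [set w : R * R | B (w.1, rho * w.1 + e * w.2)].
  rewrite -[X in measurable X]setTI.
  have : measurable_fun setT (fun w : R * R => (w.1, rho * w.1 + e * w.2)).
    by apply: measurable_fun_pair => //; exact: measurable_linear.
  exact.
have step : gamma2 [set w | B (p * w.1 + q * w.2, r * w.1 + s * w.2)] =
    gamma2 [set w | B (w.1, rho * w.1 + d * w.2)].
  have <- := gamma2_rot pq (mB' d).
  have -> // : [set w | B (p * w.1 + q * w.2, r * w.1 + s * w.2)] =
      rot p q @^-1` [set w : R * R | B (w.1, rho * w.1 + d * w.2)].
  apply/seteqP; split => w /=;
    have -> // : r * w.1 + s * w.2 = rho * (p * w.1 + q * w.2) + d * (p * w.2 - q * w.1);
    by rewrite {1}rE {1}sE; ring.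
rewrite step.
have : sg = `|d| by rewrite /sg -d2 sqrtr_sqr.
have [d0|d0] := ger0P d => sgE; first by rewrite sgE; reflexivity.
have <- := gamma2_opp2 (mB' d).
have -> : [set w : R * R | B (w.1, rho * w.1 + sg * w.2)] =
    [set w | B (w.1, rho * w.1 + d * - w.2)].
  by apply/seteqP; split => w /=; rewrite sgE mulrN mulNr.
reflexivity.
Qed.

End gaussian_plane.

(** * The law of (Z, Y) as an image of the standard Gaussian plane *)

Section canonical_law.
Context {R : realType}.
Local Notation gamma := (normal_prob (0 : R) 1).
Local Notation gamma2 := (gamma \x gamma)%E.
Implicit Types (rho : R) (B : set (R * R)).

(** The triangular (Cholesky) square root of the covariance matrix. As the first coordinate is kept,
    integrating out [w.2] is conditioning on Z. *)
Definition correl rho (w : R * R) : R * R :=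
  (w.1, rho * w.1 + Num.sqrt (1 - rho ^+ 2) * w.2).

Lemma measurable_correl rho : measurable_fun setT (correl rho).
Proof. by apply: measurable_fun_pair => //; exact: measurable_linear. Qed.

Section bivariate.
Context d (T : measurableType d) (P : probability T R) (rho : R).
Variables (Z Y : {RV P >-> R}).
Hypothesis ZY : bivariate_normal Z Y 0
  (\matrix_(i < 2, j < 2) (if i == j then 1 else rho)).

(** The equation A A^T = S says that the rows of [A] are unit vectors with inner product rho, which
    is all that [gamma2_linear] asks for. *)
Lemma bivariate_normal_correl B : measurable B ->
  P [set t | B (Z t, Y t)] = gamma2 (correl rho @^-1` B).
Proof.
move=> mB; case: ZY => A [AS]; move/(_ B mB) => ->.
have h (i j : 'I_2) : A i 0 * A j 0 + A i 1 * A j 1 = if i == j then 1 else rho.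
  move: AS => /matrixP/(_ i j); rewrite !mxE big_ord_recl big_ord1 !mxE => <-.
  by congr (_ + A i _ * A j _); exact: val_inj.
have -> : [set w : R * R | B ((0 : 'cV[R]_2) 0 0 + (A 0 0 * w.1 + A 0 1 * w.2),
                     (0 : 'cV[R]_2) 1 0 + (A 1 0 * w.1 + A 1 1 * w.2))] =
          [set w : R * R | B (A 0 0 * w.1 + A 0 1 * w.2, A 1 0 * w.1 + A 1 1 * w.2)].
  by apply/seteqP; split => w /=; rewrite !mxE !add0r.
apply: gamma2_linear mB.
- by have := h 0 0; rewrite !expr2.
- by have := h 1 1; rewrite !expr2.
- by have := h 0 1.
Qed.

(** Both sides are integrals against the same image measure. Integrability under [P] is derived from
    that under [gamma2], by comparing the integrals of |h|. *)
Lemma integral_bivariate_normal (h : R * R -> R) : measurable_fun setT h ->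
  gamma2.-integrable setT (EFin \o (h \o correl rho)) ->
  (\int[P]_t (h (Z t, Y t))%:E = \int[gamma2]_w (h (correl rho w))%:E)%E.
Proof.
move=> mh ih.
have mZY : measurable_fun setT (fun t => (Z t, Y t)) by exact: measurable_fun_pair.
(* The library has two convertible measurable structures on R, with different
   displays: the canonical one, and measurableTypeR R, which carries normal_prob. *)
have mc : measurable_fun setT
    (correl rho : measurableTypeR R * measurableTypeR R -> R * R).
  exact: measurable_correl.
have mE : measurable_fun setT (EFin \o h) by exact/measurable_EFinP.
have eqm A : measurable A -> A `<=` setT ->
    pushforward P (fun t => (Z t, Y t)) A = pushforward gamma2 (correl rho) A.
  by move=> mA _; exact: bivariate_normal_correl.
have eqi0 := @eq_measure_integral _ _ _ setT _ _ _ eqm.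
have eqi := eqi0 mc mZY.
have i2 := integrable_pushforward mc mE ih measurableT.
have mabs : measurable_fun setT (abse \o (EFin \o h)) by exact: measurableT_comp.
have e1 := ge0_integral_pushforward mZY P measurableT mabs (fun _ _ => abse_ge0 _).
have ip : P.-integrable setT ((EFin \o h) \o (fun t => (Z t, Y t))).
  apply/integrableP; split; first exact: measurableT_comp.
  have /integrableP[_] := i2; apply: le_lt_trans.
  rewrite le_eqVlt; apply/orP; left; apply/eqP.
  exact: (etrans (esym e1) (eqi _)).
have e2 := integral_pushforward mc mE ih measurableT.
have e3 := integral_pushforward mZY mE ip measurableT.
exact: (etrans (esym e3) (etrans (eqi _) e2)).
Qed.

End bivariate.
End canonical_law.

(** * Covariance of functions of linear growth *)

(** The nonnegative quantity (F x - F y)(H x - H y) is integrated in x with y fixed, then in y; the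
    result is twice the covariance. *)
Lemma chebyshev_association d (T : measurableType d) (R : realType)
    (P : probability T R) (F H : T -> R) :
  P.-integrable setT (EFin \o F) -> P.-integrable setT (EFin \o H) ->
  P.-integrable setT (EFin \o (F \* H)) ->
  (forall x y, 0 <= (F x - F y) * (H x - H y)) ->
  (\int[P]_x F x) * (\int[P]_x H x) <= \int[P]_x (F x * H x).
Proof.
move=> iF iH iFH FH0.
have iC r : P.-integrable setT (EFin \o cst r).
  exact: finite_measure_integrable_cst.
have iZ r (f : T -> R) : P.-integrable setT (EFin \o f) ->
    P.-integrable setT (EFin \o (fun x => r * f x)).
  by move=> fi; apply: (eq_integrable _ (fun x => r%:E * (f x)%:E)%E) => //;
    exact: integrableZl.
(* Serves both integrations: first with the coefficients H y, F y, F y * H y, then with the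
   integrals b, a, c. *)
have lin k l m : \int[P]_x (F x * H x - k * F x - l * H x + m) =
    \int[P]_x (F x * H x) - k * \int[P]_x F x - l * \int[P]_x H x + m.
  have i1 : P.-integrable setT (EFin \o (fun x => F x * H x - k * F x)).
    by apply: (eq_integrable _ (fun x => (F x * H x)%:E - (k * F x)%:E)%E) => //;
      apply: integrableB => //; exact: iZ.
  have i2 : P.-integrable setT (EFin \o (fun x => F x * H x - k * F x - l * H x)).
    by apply: (eq_integrable _ (fun x => (F x * H x - k * F x)%:E - (l * H x)%:E)%E) => //;
      apply: integrableB => //; exact: iZ.
  rewrite RintegralD//; last exact: iC.
  rewrite RintegralB//; last exact: iZ.
  rewrite RintegralB//; last exact: iZ.
  rewrite RintegralZl// RintegralZl// Rintegral_cst//.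
  congr (_ + _); rewrite -[RHS]mulr1; congr (_ * _).
  exact: (congr1 fine (probability_setT P)).
set a := \int[P]_x F x; set b := \int[P]_x H x; set c := \int[P]_x _.
have h y : 0 <= c - H y * a - F y * b + F y * H y.
  rewrite -lin; apply: Rintegral_ge0 => x _.
  by rewrite (le_trans (FH0 x y))// le_eqVlt; apply/orP; left; apply/eqP; ring.
have : 0 <= \int[P]_y (F y * H y - b * F y - a * H y + c).
  by apply: Rintegral_ge0 => y _; rewrite (le_trans (h y))// le_eqVlt; apply/orP;
    left; apply/eqP; ring.
rewrite lin -/a -/b -/c => hc.
have : 0 <= 2 * (c - a * b) by rewrite (le_trans hc)// le_eqVlt; apply/orP; left; apply/eqP; ring.
by rewrite pmulr_rge0// subr_ge0.
Qed.

(** * Linear growth and Gaussian integrability *)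

Section linear_growth.
Context {R : realType}.
Local Notation mu := (@lebesgue_measure R).
Local Notation gamma := (normal_prob (0 : R) 1).
Local Notation gamma2 := (gamma \x gamma)%E.
Local Notation phi := (normal_pdf (0 : R) 1).
Implicit Types (rho : R) (F G : R -> R).

Definition linear_growth F :=
  measurable_fun setT F /\ exists C, forall x, `|F x| <= C * (1 + `|x|).

Lemma linear_growth_cst r : linear_growth (cst r).
Proof.
split => //; exists `|r| => x; rewrite ler_peMr// lerDl//.
Qed.

Lemma linear_growthD F G : linear_growth F -> linear_growth G ->
  linear_growth (F \+ G).
Proof.
move=> [mF [C hC]] [mG [D hD]]; split; first exact: measurable_funD.
by exists (C + D) => x; rewrite mulrDl (le_trans (ler_normD _ _))// lerD.
Qed.

Lemma linear_growthZ r F : linear_growth F -> linear_growth (fun x => r * F x).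
Proof.
move=> [mF [C hC]]; split; first exact: measurable_funM.
by exists (`|r| * C) => x; rewrite normrM -mulrA ler_wpM2l.
Qed.

Lemma linear_growth_sum (n : nat) (h : nat -> R -> R) :
  (forall i, linear_growth (h i)) ->
  linear_growth (fun x => \sum_(1 <= i < n.+1) h i x).
Proof.
move=> hh; elim: n => [|n ih].
  under eq_fun do rewrite big_geq//; exact: linear_growth_cst.
under eq_fun do rewrite big_nat_recr//=.
exact: linear_growthD.
Qed.

(* A majorant of products of functions of linear growth that, being a product of
   powers, is integrable for gamma2 by Tonelli. *)
Definition wgt (x : R) := (1 + `|x|) ^+ 2.

Lemma wgt_ge0 x : 0 <= wgt x. Proof. by rewrite sqr_ge0. Qed.

Lemma measurable_wgt : measurable_fun setT wgt.
Proof. by apply: measurable_funX; apply: measurable_funD => //; exact: normr_measurable. Qed.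

Lemma wgt_pdf_le x : wgt x * phi x <=
  (16 / 3 * normal_peak 1 / normal_peak 2) * normal_pdf 0 2 x.
Proof.
have p2 : normal_peak (2 : R) != 0 by rewrite gt_eqF// normal_peak_gt0.
rewrite normal_pdf01E normal_pdfE// /normal_fun subr0.
set p1 := normal_peak 1; set p2' := normal_peak 2.
set e1 := expR _; set e2 := expR _.
have -> : 16 / 3 * p1 / p2' * (p2' * e2) = p1 * (16 / 3 * e2) by field.
rewrite mulrCA ler_wpM2l ?normal_peak_ge0//.
have -> : e2 = expR (3 * x ^+ 2 / 8) * e1.
  by rewrite -expRD; congr expR; field.
rewrite mulrA ler_wpM2r ?expR_ge0//.
have := expR_ge1Dx (3 * x ^+ 2 / 8).
have n2 : `|x| ^+ 2 = x ^+ 2 by rewrite real_normK ?num_real.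
have : 0 <= (1 - `|x|) ^+ 2 by rewrite sqr_ge0.
have -> : (1 - `|x|) ^+ 2 = 1 - 2 * `|x| + x ^+ 2 by rewrite -n2; ring.
have -> : wgt x = 1 + 2 * `|x| + x ^+ 2 by rewrite /wgt -n2; ring.
lra.
Qed.

Lemma integrable_wgt : gamma.-integrable setT (EFin \o wgt).
Proof.
apply/integrableP; split; first by apply/measurable_EFinP; exact: measurable_wgt.
rewrite ge0_integral_normal_prob//; last first.
  by apply: measurableT_comp => //; apply/measurable_EFinP; exact: measurable_wgt.
pose c : R := 16 / 3 * normal_peak 1 / normal_peak 2.
have c0 : 0 <= c by rewrite !mulr_ge0 ?invr_ge0 ?normal_peak_ge0.
apply: (@le_lt_trans _ _ (\int[mu]_x (c%:E * (normal_pdf 0 2 x)%:E))%E).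
  apply: ge0_le_integral => //.
  - by move=> x _; rewrite mule_ge0// lee_fin normal_pdf_ge0.
  - apply: emeasurable_funM.
      by apply: measurableT_comp => //; apply/measurable_EFinP; exact: measurable_wgt.
    by apply/measurable_EFinP; exact: measurable_normal_pdf.
  - apply: emeasurable_funM => //.
    by apply/measurable_EFinP; exact: measurable_normal_pdf.
  - move=> x _ /=; rewrite ger0_norm ?wgt_ge0// -!EFinM lee_fin.
    exact: wgt_pdf_le.
rewrite ge0_integralZl//.
- by rewrite integral_normal_pdf mule1 ltry.
- by apply/measurable_EFinP; exact: measurable_normal_pdf.
- by move=> x _; rewrite lee_fin normal_pdf_ge0.
Qed.

Lemma integrable_wgt2 :
  gamma2.-integrable setT (EFin \o (fun w : R * R => wgt w.1 * wgt w.2)).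
Proof.
have mw : measurable_fun setT (EFin \o (fun w : R * R => wgt w.1 * wgt w.2)).
  apply/measurable_EFinP; apply: measurable_funM;
    apply: measurableT_comp => //; exact: measurable_wgt.
apply/integrable12ltyP => //.
have ifin : (\int[gamma]_x (wgt x)%:E < +oo)%E.
  have /integrableP[_] := integrable_wgt.
  by under eq_integral do rewrite /= ger0_norm ?wgt_ge0//.
have e (x : R) : (\int[gamma]_y `|(wgt x * wgt y)%:E| = (wgt x)%:E * \int[gamma]_x (wgt x)%:E)%E.
  under eq_integral do rewrite gee0_abs ?lee_fin ?mulr_ge0 ?wgt_ge0// EFinM.
  rewrite ge0_integralZl//.
  - by apply/measurable_EFinP; exact: measurable_wgt.
  - by move=> y _; rewrite lee_fin wgt_ge0.
  - by rewrite lee_fin wgt_ge0.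
rewrite (eq_integral (fun x : measurableTypeR R => (wgt x)%:E * \int[gamma]_x (wgt x)%:E)%E); last first.
  by move=> x _; exact: e.
rewrite ge0_integralZr//.
- by rewrite lte_mul_pinfty// ?ge0_fin_numE// ?integral_ge0// => y _; rewrite lee_fin wgt_ge0.
- by apply/measurable_EFinP; exact: measurable_wgt.
- by move=> y _; rewrite lee_fin wgt_ge0.
- by apply: integral_ge0 => y _; rewrite lee_fin wgt_ge0.
Qed.

End linear_growth.

(** * Bilinearity and positivity of the covariance *)

Section gaussian_covariance.
Context {R : realType}.
Local Notation gamma := (normal_prob (0 : R) 1).
Local Notation gamma2 := (gamma \x gamma)%E.
Implicit Types (F G H : R -> R).

Variable rho : R.
Hypothesis rho01 : 0 <= rho <= 1.

Local Notation C := (correl rho).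

(** Bounds a product F(Z) G(Y) by a multiple of (1 + |w.1|)^2 (1 + |w.2|), which the squares in
    [wgt] absorb. *)
Lemma norm_correl2_le (w : R * R) : 1 + `|(C w).2| <= (1 + `|w.1|) * (1 + `|w.2|).
Proof.
have /andP[r0 r1] := rho01.
set s := Num.sqrt (1 - rho ^+ 2).
have s0 : 0 <= s by rewrite sqrtr_ge0.
have s1 : s <= 1.
  by rewrite -[leRHS]sqrtr1 ler_wsqrtr// lerBlDr lerDl sqr_ge0.
have h1 : `|rho * w.1| <= `|w.1| by rewrite normrM ger0_norm// ler_piMl.
have h2 : `|s * w.2| <= `|w.2| by rewrite normrM (ger0_norm s0) ler_piMl.
have := ler_normD (rho * w.1) (s * w.2); rewrite -/s /correl/= -/s.
have : 0 <= `|w.1| * `|w.2| by rewrite mulr_ge0.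
lra.
Qed.

Lemma measurable_correl_prod F G : measurable_fun setT F -> measurable_fun setT G ->
  measurable_fun setT (fun w : R * R => F (C w).1 * G (C w).2).
Proof.
move=> mF mG; apply: measurable_funM.
  exact: (measurableT_comp mF (@measurable_fst _ _ _ _)).
by apply: (measurableT_comp mG); exact: measurable_linear.
Qed.

Lemma integrable_correl_prod F G : linear_growth F -> linear_growth G ->
  gamma2.-integrable setT (EFin \o (fun w : R * R => F (C w).1 * G (C w).2)).
Proof.
move=> [mF [c hF]] [mG [e hG]].
have c0 : 0 <= c by have := le_trans (normr_ge0 _) (hF 0); rewrite normr0 addr0 mulr1.
have e0 : 0 <= e by have := le_trans (normr_ge0 _) (hG 0); rewrite normr0 addr0 mulr1.
apply: (le_integrable measurableT _ _ (integrableZl measurableT (c * e) integrable_wgt2)); last first.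
- move=> w _ /=; rewrite lee_fin normrM.
  rewrite [leRHS]ger0_norm; last by rewrite !mulr_ge0 ?wgt_ge0.
  apply: (@le_trans _ _ ((c * (1 + `|w.1|)) * (e * ((1 + `|w.1|) * (1 + `|w.2|))))).
    rewrite ler_pM// (le_trans (hG _))// ler_wpM2l//.
    exact: norm_correl2_le.
  rewrite mulrACA ler_wpM2l ?mulr_ge0// /wgt !expr2 -!mulrA ler_wpM2l ?addr_ge0//.
  by rewrite ler_wpM2l ?addr_ge0// ler_peMr ?addr_ge0// lerDl.
- by apply/measurable_EFinP; exact: measurable_correl_prod.
Qed.

(* E[F(Z) G(Y)] when (Z, Y) is standard binormal with correlation rho *)
Definition dotp F G : R := \int[gamma2]_w (F (C w).1 * G (C w).2).

Lemma dotpDl F G H : linear_growth F -> linear_growth G -> linear_growth H ->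
  dotp (F \+ G) H = dotp F H + dotp G H.
Proof.
move=> gF gG gH; rewrite /dotp -RintegralD//; try exact: integrable_correl_prod.
by apply: eq_Rintegral => w _ /=; rewrite mulrDl.
Qed.

Lemma dotpDr F G H : linear_growth F -> linear_growth G -> linear_growth H ->
  dotp F (G \+ H) = dotp F G + dotp F H.
Proof.
move=> gF gG gH; rewrite /dotp -RintegralD//; try exact: integrable_correl_prod.
by apply: eq_Rintegral => w _ /=; rewrite mulrDr.
Qed.

Lemma dotpZl r F G : linear_growth F -> linear_growth G ->
  dotp (fun x => r * F x) G = r * dotp F G.
Proof.
move=> gF gG; rewrite /dotp -RintegralZl//; last exact: integrable_correl_prod.
by apply: eq_Rintegral => w _ /=; rewrite mulrA.
Qed.

Lemma dotpZr r F G : linear_growth F -> linear_growth G ->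
  dotp F (fun x => r * G x) = r * dotp F G.
Proof.
move=> gF gG; rewrite /dotp -RintegralZl//; last exact: integrable_correl_prod.
by apply: eq_Rintegral => w _ /=; rewrite mulrCA.
Qed.

(** Single expectations are written as [dotp] with the constant 1, so that bilinearity of [dotp]
    passes to [cov]. *)
Definition cov F G : R := dotp F G - dotp F (cst 1) * dotp (cst 1) G.

Lemma covDl F G H : linear_growth F -> linear_growth G -> linear_growth H ->
  cov (F \+ G) H = cov F H + cov G H.
Proof.
move=> gF gG gH; have g1 := linear_growth_cst (1 : R).
by rewrite /cov !dotpDl//; ring.
Qed.

Lemma covDr F G H : linear_growth F -> linear_growth G -> linear_growth H ->
  cov F (G \+ H) = cov F G + cov F H.
Proof.
move=> gF gG gH; have g1 := linear_growth_cst (1 : R).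
by rewrite /cov !dotpDr//; ring.
Qed.

Lemma covZl r F G : linear_growth F -> linear_growth G ->
  cov (fun x => r * F x) G = r * cov F G.
Proof.
move=> gF gG; have g1 := linear_growth_cst (1 : R).
by rewrite /cov !dotpZl//; ring.
Qed.

Lemma covZr r F G : linear_growth F -> linear_growth G ->
  cov F (fun x => r * G x) = r * cov F G.
Proof.
move=> gF gG; have g1 := linear_growth_cst (1 : R).
by rewrite /cov !dotpZr//; ring.
Qed.

Lemma cov0l G : cov (cst 0) G = 0.
Proof.
have e H : dotp (cst 0) H = 0.
  by rewrite /dotp; under eq_Rintegral do rewrite /= mul0r; rewrite Rintegral_cst// mul0r.
by rewrite /cov !e mul0r subr0.
Qed.

Lemma cov0r F : cov F (cst 0) = 0.
Proof.
have e H : dotp H (cst 0) = 0.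
  by rewrite /dotp; under eq_Rintegral do rewrite /= mulr0; rewrite Rintegral_cst// mul0r.
by rewrite /cov !e mulr0 subr0.
Qed.

Lemma cov_suml (n : nat) (h : nat -> R -> R) G :
  (forall i, linear_growth (h i)) -> linear_growth G ->
  cov (fun x => \sum_(1 <= i < n.+1) h i x) G = \sum_(1 <= i < n.+1) cov (h i) G.
Proof.
move=> gh gG; elim: n => [|n ih].
  by rewrite big_geq//; under eq_fun do rewrite big_geq//; exact: cov0l.
have gs := linear_growth_sum n gh.
have -> : (fun x => \sum_(1 <= i < n.+2) h i x) =
    (fun x => \sum_(1 <= i < n.+1) h i x) \+ h n.+1.
  by apply/funext => x; rewrite /= big_nat_recr.
by rewrite (covDl gs (gh n.+1) gG) ih [RHS]big_nat_recr.
Qed.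

Lemma cov_sumr (n : nat) F (h : nat -> R -> R) :
  linear_growth F -> (forall i, linear_growth (h i)) ->
  cov F (fun x => \sum_(1 <= i < n.+1) h i x) = \sum_(1 <= i < n.+1) cov F (h i).
Proof.
move=> gF gh; elim: n => [|n ih].
  by rewrite big_geq//; under eq_fun do rewrite big_geq//; exact: cov0r.
have gs := linear_growth_sum n gh.
have -> : (fun x => \sum_(1 <= i < n.+2) h i x) =
    (fun x => \sum_(1 <= i < n.+1) h i x) \+ h n.+1.
  by apply/funext => x; rewrite /= big_nat_recr.
by rewrite (covDr gF gs (gh n.+1)) ih [RHS]big_nat_recr.
Qed.

Lemma linear_growth_section G (c e : R) : linear_growth G ->
  linear_growth (fun y => G (c + e * y)).
Proof.
move=> [mG [k hG]]; split.
  by apply: (measurableT_comp mG); apply: measurable_funD => //; exact: measurable_funM.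
have k0 : 0 <= k by have := le_trans (normr_ge0 _) (hG 0); rewrite normr0 addr0 mulr1.
exists (k * ((1 + `|c|) * (1 + `|e|))) => y; rewrite (le_trans (hG _))// -mulrA ler_wpM2l//.
have := ler_normD c (e * y); rewrite normrM.
have : 0 <= `|c| * `|e| by rewrite mulr_ge0.
have : 0 <= `|c| * `|y| by rewrite mulr_ge0.
have : 0 <= `|c| * `|e| * `|y| by rewrite !mulr_ge0.
have := normr_ge0 y; have := normr_ge0 e; have := normr_ge0 c.
lra.
Qed.

Lemma integrable_gamma F : linear_growth F -> gamma.-integrable setT (EFin \o F).
Proof.
move=> [mF [k hF]].
have k0 : 0 <= k by have := le_trans (normr_ge0 _) (hF 0); rewrite normr0 addr0 mulr1.
apply: (le_integrable measurableT _ _ (integrableZl measurableT k integrable_wgt)); last first.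
- move=> x _ /=; rewrite lee_fin.
  rewrite [leRHS]ger0_norm; last by rewrite !mulr_ge0 ?wgt_ge0.
  rewrite (le_trans (hF _))// ler_wpM2l// /wgt expr2 ler_peMr ?addr_ge0//.
  by rewrite lerDl.
- exact/measurable_EFinP.
Qed.

Lemma cov_ge0 F G : linear_growth F -> linear_growth G ->
  {homo F : x y / x <= y} -> {homo G : x y / x <= y} -> 0 <= cov F G.
Proof.
move=> gF gG ndF ndG.
have /andP[r0 r1] := rho01.
pose s := Num.sqrt (1 - rho ^+ 2).
pose H x := \int[gamma]_y G (rho * x + s * y).
have ndH : {homo H : x y / x <= y}.
  move=> x x' xx'; apply: le_Rintegral => //.
  - exact: (integrable_gamma (linear_growth_section _ _ gG)).
  - exact: (integrable_gamma (linear_growth_section _ _ gG)).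
  - by move=> y _; apply: ndG; rewrite lerD2r ler_wpM2l.
have g1 := linear_growth_cst (1 : R).
(* [H x] is E[G(Y) | Z = x]. Fubini gives E[F'(Z) G(Y)] as an integral in x alone; the choices F' =
   F and F' = 1 yield E[F(Z) G(Y)] and E[G(Y)]. *)
have red F' : linear_growth F' ->
    gamma.-integrable setT (EFin \o (fun x => F' x * H x)) /\
    dotp F' G = \int[gamma]_x (F' x * H x).
  move=> gF'; have ii := integrable_correl_prod gF' gG.
  have E x : fubini_F gamma (EFin \o (fun w : R * R => F' (C w).1 * G (C w).2)) x =
      (F' x * H x)%:E.
    rewrite /fubini_F /= EFinM /H /Rintegral fineK; last first.
      by apply: integrable_fin_num => //; exact: (integrable_gamma (linear_growth_section _ _ gG)).
    rewrite -integralZl//; exact: (integrable_gamma (linear_growth_section _ _ gG)).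
  split.
    by move: (integrable_fubini_F ii); apply: eq_integrable => // x _; exact: E.
  rewrite /dotp /Rintegral -(integral12_prod_meas1 ii); congr fine.
  by apply: eq_integral => x _; exact: E.
have [iFH eFH] := red _ gF.
have [iH eH] := red _ g1.
have eF : dotp F (cst 1) = \int[gamma]_x F x.
  rewrite /dotp /Rintegral -(integral12_prod_meas1 (integrable_correl_prod gF g1)); congr fine.
  apply: eq_integral => x _; rewrite /fubini_F /= mulr1 integral_cst//.
  by rewrite -[RHS]mule1; congr (_ * _)%E; exact: (probability_setT gamma).
have H1 : (fun x => cst 1 x * H x) = H by apply/funext => x /=; rewrite mul1r.
rewrite H1 in iH eH.
rewrite /cov eFH eF eH subr_ge0; apply: chebyshev_association => //.
- exact: integrable_gamma.
- move=> x y; have [xy|yx] := leP x y.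
    by rewrite mulr_le0// subr_le0; [exact: ndF|exact: ndH].
  by rewrite mulr_ge0// subr_ge0; [apply: ndF|apply: ndH]; exact: ltW.
Qed.

End gaussian_covariance.

(** * Plackett's identity for quadrant probabilities *)

Section conditional_threshold.
Context {R : realType}.
Implicit Types (b z u : R).

Let s u : R := Num.sqrt (1 - u ^+ 2).

(* Given the first coordinate z, the second coordinate of [correl u (z, y)]
   exceeds b iff y > thr b z u, for |u| < 1; dthr is d thr / d u. *)
Definition thr b z u : R := (b - u * z) / Num.sqrt (1 - u ^+ 2).

Definition dthr b z u : R := (u * b - z) / Num.sqrt (1 - u ^+ 2) ^+ 3.

Lemma onem_sqr_gt0 u : -1 < u < 1 -> 0 < 1 - u ^+ 2.
Proof.
move=> /andP[u1 u2]; rewrite (_ : 1 - u ^+ 2 = (1 - u) * (1 + u)); last by ring.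
by rewrite mulr_gt0//; lra.
Qed.

Lemma is_derive_thr b z u : -1 < u < 1 ->
  is_derive u 1 (thr b z) (dthr b z u).
Proof.
move=> u1; have su0 : 0 < s u by rewrite sqrtr_gt0 onem_sqr_gt0.
have s2 : s u ^+ 2 = 1 - u ^+ 2 by rewrite sqr_sqrtr// ltW// onem_sqr_gt0.
have hs : is_derive u 1 s (- u / s u).
  have h1 : is_derive u 1 (fun u : R => 1 - u ^+ 2) (- (2 * u)).
    apply: is_derive_eq.
    by rewrite /GRing.scale/=; ring.
  have := is_derive1_sqrt (onem_sqr_gt0 u1) => h2.
  have := @is_derive1_comp _ Num.sqrt (fun u : R => 1 - u ^+ 2) u _ _ h2 h1.
  move=> h3; apply: is_derive_eq h3 _.
  by rewrite -/(s u); field; rewrite gt_eqF.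
have hV := is_deriveV (lt0r_neq0 su0) hs.
have hn : is_derive u 1 (fun u : R => b - u * z) (- z).
  apply: is_derive_eq.
  by rewrite /GRing.scale/=; ring.
have := is_deriveM hn hV => h.
apply: is_derive_eq h _.
rewrite /dthr -/(s u) /GRing.scale/=.
apply: (@mulIf _ (s u ^+ 3)); first by rewrite expf_neq0// gt_eqF.
rewrite divfK ?expf_neq0 ?gt_eqF//.
transitivity ((b - u * z) * u - z * s u ^+ 2); first by field; rewrite gt_eqF.
by rewrite s2; ring.
Qed.

Lemma continuous_sqrt_onem u : {for u, continuous (fun u : R => Num.sqrt (1 - u ^+ 2))}.
Proof.
apply: continuous_comp; last exact: sqrt_continuous.
by apply: cvgB; [exact: cvg_cst|exact: sqr_continuous].
Qed.

Lemma continuous_dthr b z u : -1 < u < 1 -> {for u, continuous (dthr b z)}.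
Proof.
move=> u1; apply: cvgM.
  by apply: cvgB; [apply: cvgM; [exact: cvg_id|exact: cvg_cst]|exact: cvg_cst].
have c := @continuous_sqrt_onem u.
have s0 : Num.sqrt (1 - u ^+ 2) ^+ 3 != 0.
  by rewrite expf_neq0// gt_eqF// sqrtr_gt0 onem_sqr_gt0.
apply: cvgV => //.
apply: (cvg_comp _ (fun x : R => x ^+ 3)); first exact: c.
exact: exprn_continuous.
Qed.

Lemma thr0 b z : thr b z 0 = b.
Proof. by rewrite /thr mul0r subr0 expr0n/= subr0 sqrtr1 divr1. Qed.

Variables (b z rho : R).
Hypotheses (z0 : 0 < z) (bz : b < z) (rho0 : 0 <= rho) (rho1 : rho < 1).

Let in11 u : u \in `[0, rho] -> -1 < u < 1.
Proof. rewrite in_itv/= => /andP[u0 ur]; apply/andP; split; [by lra|exact: le_lt_trans ur rho1]. Qed.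

Let in11' u : u \in `]0, rho[ -> -1 < u < 1.
Proof. by move=> ur; apply: in11; move: ur; rewrite !in_itv/= => /andP[/ltW-> /ltW->]. Qed.

Let deriv1 u : -1 < u < 1 -> (thr b z)^`()%classic u = dthr b z u.
Proof. by move=> u1; rewrite derive1E; have /@derive_val := is_derive_thr b z u1. Qed.

(** The sign is that of u b - z. If b >= 0 then u b <= b < z, and otherwise u b <= 0 < z: both
    bounds on z are used here. *)
Lemma dthr_lt0 u : u \in `[0, rho] -> dthr b z u < 0.
Proof.
move=> u01; have s0 : 0 < Num.sqrt (1 - u ^+ 2) ^+ 3.
  by rewrite exprn_gt0// sqrtr_gt0 onem_sqr_gt0// in11.
rewrite /dthr pmulr_llt0 ?invr_gt0//.
move: u01; rewrite in_itv/= => /andP[u0 ur].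
have u1 := ltW (le_lt_trans ur rho1); have := z0; have := bz.
have [b0|b0] := leP 0 b; first by have := ler_piMl b0 u1; lra.
have : u * b <= 0 by rewrite mulr_ge0_le0// ltW.
lra.
Qed.

Let cont u : -1 < u < 1 -> {for u, continuous (thr b z)}.
Proof.
move=> u1; apply/differentiable_continuous/derivable1_diffP.
by have /@ex_derive := is_derive_thr b z u1.
Qed.

Lemma thr_decreasing : {in `[0, rho] &, {homo thr b z : x y /~ x < y}}.
Proof.
have d1 u : u \in `]0, rho[ -> derivable (thr b z) u 1.
  by move=> /in11' u1; have /@ex_derive := is_derive_thr b z u1.
have d2 u : u \in `]0, rho[ -> (thr b z)^`()%classic u < 0.
  move=> ur; rewrite deriv1 ?in11'//; apply: dthr_lt0.
  exact: subset_itv_oo_cc.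
have c : {within `[0, rho], continuous (thr b z)}.
  by apply: continuous_in_subspaceT => u; rewrite inE => /in11; exact: cont.
move=> y x; rewrite !in_itv/= => /andP[y0 yr] /andP[x0 xr] xy.
exact: (ltr0_derive1_decr d1 d2 c).
Qed.

Let contD u : -1 < u < 1 -> {for u, continuous (thr b z)^`()%classic}.
Proof.
move=> u1; have c := @continuous_dthr b z u u1.
rewrite /prop_for /continuous_at deriv1//.
apply: cvg_trans c; apply: near_eq_cvg.
have : u \in `]-1, 1[ by rewrite in_itv.
move=> /near_in_itvoo; apply: filterS => x; rewrite in_itv => x1.
by rewrite deriv1.
Qed.

(** The substitution y = thr b z u, which decreases from b at u = 0 to [thr b z rho]. *)
Lemma integral_thr (G : R -> R) : continuous G ->
  (\int[lebesgue_measure]_(y in `[thr b z rho, b]) (G y)%:E =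
   \int[lebesgue_measure]_(u in `[0%R, rho]) (G (thr b z u) * - dthr b z u)%:E)%E.
Proof.
move=> cG.
have i0 : 0 \in `[0, rho] by rewrite in_itv/= lexx.
have ir : rho \in `[0, rho] by rewrite in_itv/= lexx andbT.
have := @integration_by_substitution_decreasing _ (thr b z) G _ _ rho0 thr_decreasing.
rewrite thr0 => -> //.
- apply: eq_integral => u; rewrite inE => /in11 u1 /=.
  by rewrite !fctE /= deriv1.
- by move=> u /in11'; exact: contD.
- by apply/cvg_ex; exists ((thr b z)^`()%classic 0); apply: cvg_at_right_filter; apply: contD; exact: in11.
- by apply/cvg_ex; exists ((thr b z)^`()%classic rho); apply: cvg_at_left_filter; apply: contD; exact: in11.
- split.
  + by move=> u /in11' u1; have /@ex_derive := is_derive_thr b z u1.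
  + by apply: cvg_at_right_filter; apply: cont; exact: in11.
  + by apply: cvg_at_left_filter; apply: cont; exact: in11.
- exact: continuous_subspaceT.
Qed.

End conditional_threshold.

(** * The bivariate density along the threshold *)

Section conditional_density.
Context {R : realType}.
Local Notation mu := (@lebesgue_measure R).
Local Notation phi := (normal_pdf (0 : R) 1).
Implicit Types (a b z u : R).

Lemma normal_peak1_sqr : normal_peak (1 : R) * normal_peak 1 = (2 * pi)^-1.
Proof.
rewrite /normal_peak expr1n mul1r -invfM -expr2 sqr_sqrtr ?mulr_natl//.
by rewrite mulrn_wge0// pi_ge0.
Qed.

Lemma normal_pdf_thr b z u : -1 < u < 1 ->
  phi z * phi (thr b z u) =
  (2 * pi)^-1 * expR (- (z ^+ 2 / 2)) *
  expR (- ((b - z * u) ^+ 2 / (2 * (1 - u ^+ 2)))).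
Proof.
move=> u1; have s0 := onem_sqr_gt0 u1.
rewrite !normal_pdf01E mulrACA normal_peak1_sqr -[RHS]mulrA; congr (_ * (_ * expR _)).
rewrite /thr exprMn exprVn sqr_sqrtr ?ltW//.
by field; rewrite gt_eqF.
Qed.

(** The exponent is -(z^2 - 2 u z b + b^2) / (2 (1 - u^2)), symmetric in z and b. *)
Lemma normal_pdf_thrC b z u : -1 < u < 1 ->
  phi z * phi (thr b z u) = phi b * phi (thr z b u).
Proof.
move=> u1; have s0 := onem_sqr_gt0 u1.
rewrite !normal_pdf_thr// -[LHS]mulrA -[RHS]mulrA; congr (_ * _); rewrite -!expRD; congr expR.
by field; rewrite gt_eqF.
Qed.

Lemma is_derive_expR_sqr (c k z : R) :
  is_derive z 1 (fun z : R => expR (- ((z - c) ^+ 2 / k)))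
    (expR (- ((z - c) ^+ 2 / k)) * - (2 * (z - c) / k)).
Proof.
have h : is_derive z 1 (fun z : R => - ((z - c) ^+ 2 / k)) (- (2 * (z - c) / k)).
  apply: is_derive_eq.
  by rewrite /GRing.scale/=; ring.
exact: (is_derive1_comp (is_derive_expR _) h).
Qed.

Lemma cvgy_expR_sqr (c k : R) : 0 < k ->
  expR (- ((z - c) ^+ 2 / k)) @[z --> +oo] --> (0 : R).
Proof.
move=> k0.
have sk : 0 < (Num.sqrt k)^-1 by rewrite invr_gt0 sqrtr_gt0.
have -> : (fun z => expR (- ((z - c) ^+ 2 / k))) =
    (@gauss_fun R) \o (fun z => (z - c) * (Num.sqrt k)^-1).
  apply/funext => z /=; rewrite /gauss_fun exprMn exprVn sqr_sqrtr//; exact: ltW.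
apply: (@cvg_comp _ _ _ _ _ _ +oo); last exact: cvg_gauss_fun.
by apply: gt0_cvgMly => //; exact: cvg_addrr.
Qed.

(** After exchanging z and b, the dependence on z is a Gaussian centred at u b, and [- dthr]
    supplies the factor z - u b that makes the integrand an exact derivative. The condition u b <= a
    makes it nonnegative on the half-line; a second exchange brings the value at a to the required
    form. *)
Lemma integral_normal_pdf_thr a b u : -1 < u < 1 -> u * b <= a ->
  (\int[mu]_(z in `]a, +oo[) (phi z * phi (thr b z u) * - dthr b z u)%:E =
   ((2 * pi)^-1 * expR (- (a ^+ 2 / 2)))%:E *
   ((Num.sqrt (1 - u ^+ 2))^-1 *
    expR (- ((b - a * u) ^+ 2 / (2 * (1 - u ^+ 2)))))%:E)%E.
Proof.
move=> u1 uba; have s0 := onem_sqr_gt0 u1.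
set s := Num.sqrt (1 - u ^+ 2).
have sgt0 : 0 < s by rewrite sqrtr_gt0.
have s2 : s ^+ 2 = 1 - u ^+ 2 by rewrite sqr_sqrtr// ltW.
pose e z := expR (- ((z - b * u) ^+ 2 / (2 * (1 - u ^+ 2)))).
pose k : R := (2 * pi)^-1 * expR (- (b ^+ 2 / 2)) / s.
pose F z := (- k) * e z.
have fE z : phi z * phi (thr b z u) * - dthr b z u =
    k * (e z * (2 * (z - b * u) / (2 * (1 - u ^+ 2)))).
  rewrite normal_pdf_thrC// normal_pdf_thr// -/(e z) /k /dthr -/s -s2.
  by set c2 := (2 * pi)^-1; field; rewrite gt_eqF.
have dF z : is_derive z 1 F (k * (e z * (2 * (z - b * u) / (2 * (1 - u ^+ 2))))).
  have h := is_derive_expR_sqr (b * u) (2 * (1 - u ^+ 2)) z.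
  have h2 := is_deriveZ (- k) h.
  apply: is_derive_eq h2 _.
  by rewrite /GRing.scale/= -/(e z); ring.
have k0 : 0 <= k.
  apply: divr_ge0; last exact: ltW.
  by rewrite mulr_ge0 ?expR_ge0// invr_ge0 mulr_ge0// pi_ge0.
under eq_integral do rewrite fE.
pose f z := k * (e z * (2 * (z - b * u) / (2 * (1 - u ^+ 2)))).
have cF : continuous F.
  move=> z; apply/differentiable_continuous/derivable1_diffP.
  by have /@ex_derive := dF z.
have ce : continuous e.
  move=> z; apply/differentiable_continuous/derivable1_diffP.
  by have /@ex_derive := is_derive_expR_sqr (b * u) (2 * (1 - u ^+ 2)) z.
have cf : continuous f.
  move=> z; apply: cvgM; first exact: cvg_cst.
  apply: cvgM; first exact: ce.
  apply: cvgM; last exact: cvg_cst.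
  apply: cvgM; first exact: cvg_cst.
  by apply: cvgB; [exact: cvg_id|exact: cvg_cst].
rewrite integral_itv_obnd_cbnd; last first.
  apply/measurable_funTS/measurable_EFinP; exact: continuous_measurable_fun.
rewrite (@ge0_continuous_FTC2y _ f F a 0).
- rewrite sub0e -EFinN -EFinM; congr EFin.
  rewrite /F mulNr opprK /k /e.
  transitivity (phi b * phi (thr a b u) / s).
    by rewrite normal_pdf_thr//; ring.
  by rewrite normal_pdf_thrC// normal_pdf_thr// mulrAC -[LHS]mulrA.
- move=> z az; rewrite /f mulr_ge0// mulr_ge0 ?expR_ge0// divr_ge0//.
    by rewrite mulr_ge0// subr_ge0 (le_trans _ az)// mulrC.
  by rewrite mulr_ge0// ltW.
- exact: continuous_subspaceT.
- rewrite -[X in _ --> X](mulr0 (- k)); apply: cvgM; first exact: cvg_cst.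
  by apply: cvgy_expR_sqr; rewrite mulr_gt0.
- by move=> z _; have /@ex_derive := dF z.
- by apply: cvg_at_right_filter; exact: cF.
- by move=> z _; rewrite derive1E; have /@derive_val := dF z.
Qed.

End conditional_density.

(** * Plackett's identity by Tonelli's theorem *)

Section plackett.
Context {R : realType}.
Local Notation mu := (@lebesgue_measure R).
Local Notation gamma := (normal_prob (0 : R) 1).
Local Notation gamma2 := (gamma \x gamma)%E.
Local Notation phi := (normal_pdf (0 : R) 1).
Implicit Types a b z u rho : R.

(** Extended-valued because at rho = 1 the integrand can be unbounded near u = 1; finiteness is a
    consequence of the covariance bound, in [plackett_term_fin_num]. *)
Definition plackett_integral a b rho : \bar R :=
  (\int[mu]_(u in `[0%R, rho])
       ((Num.sqrt (1 - u ^+ 2))^-1 *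
        expR (- ((b - a * u) ^+ 2 / (2 * (1 - u ^+ 2)))))%:E)%E.

(** The inverse is the power -1, measurable on the whole line; the two agree on nonnegative reals,
    including at 0. *)
Lemma measurable_inv_sqrt_onem d (T : measurableType d) (h : T -> R) :
  measurable_fun setT h ->
  measurable_fun setT (fun t => (Num.sqrt (1 - h t ^+ 2))^-1).
Proof.
move=> mh.
have -> : (fun t => (Num.sqrt (1 - h t ^+ 2))^-1) =
    (fun x : R => x `^ (-1)) \o Num.sqrt \o (fun t => 1 - h t ^+ 2).
  by apply/funext => t /=; rewrite powR_inv1// sqrtr_ge0.
apply: measurableT_comp; last first.
  by apply: measurable_funB => //; exact: measurable_funX.
apply: measurableT_comp; first exact: measurable_powR.
by apply: continuous_measurable_fun; exact: sqrt_continuous.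
Qed.

Lemma measurable_thr d (T : measurableType d) b (h k : T -> R) :
  measurable_fun setT h -> measurable_fun setT k ->
  measurable_fun setT (fun t => thr b (h t) (k t)).
Proof.
move=> mh mk; apply: measurable_funM; last exact: measurable_inv_sqrt_onem.
by apply: measurable_funB => //; exact: measurable_funM.
Qed.

Lemma measurable_dthr d (T : measurableType d) b (h k : T -> R) :
  measurable_fun setT h -> measurable_fun setT k ->
  measurable_fun setT (fun t => dthr b (h t) (k t)).
Proof.
move=> mh mk; apply: measurable_funM.
  by apply: measurable_funB => //; exact: measurable_funM.
under eq_fun do rewrite -exprVn.
by apply: measurable_funX; exact: measurable_inv_sqrt_onem.
Qed.

Lemma measurable_plackett a b : measurable_fun (`[0, 1] : set R)
  (fun u => (Num.sqrt (1 - u ^+ 2))^-1 *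
    expR (- ((b - a * u) ^+ 2 / (2 * (1 - u ^+ 2))))).
Proof.
have mid : measurable_fun setT (fun u : R => u) by exact: measurable_id.
have mV := measurable_inv_sqrt_onem mid.
(* On [0, 1] the factor 1 / (1 - u^2) is the square of the inverse root, whose measurability is
   known. *)
apply: (eq_measurable_fun (fun u => (Num.sqrt (1 - u ^+ 2))^-1 *
    expR (- ((b - a * u) ^+ 2 / 2 * (Num.sqrt (1 - u ^+ 2))^-1 ^+ 2)))).
  move=> u; rewrite inE/= in_itv/= => /andP[u0 u1]; congr (_ * expR (- _)).
  rewrite exprVn sqr_sqrtr; last by rewrite subr_ge0 exprn_ile1.
  by rewrite invfM mulrA.
apply/measurable_funTS; apply: measurable_funM => //.
apply: measurableT_comp => //; apply: measurableT_comp => //.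
apply: measurable_funM; last exact: measurable_funX.
apply: measurable_funM => //; apply: measurable_funX.
by apply: measurable_funB => //; exact: measurable_funM.
Qed.

Definition orthant (a b r : R) : set (R * R) :=
  [set w | a < w.1 /\ b < (correl r w).2].

(* - dthr is |d thr / d u| where dthr is negative. *)
Definition plackett_kernel b z u : R := phi z * phi (thr b z u) * - dthr b z u.

Variables (a b rho : R).
Hypotheses (a0 : 0 <= a) (ba : b <= a) (rho0 : 0 <= rho) (rho1 : rho < 1).

(** The indicators extend the kernel by 0, so that Tonelli applies on the whole plane: the kernel
    alone need not be nonnegative for z <= a. *)
Let K (w : R * R) : \bar R :=
  (\1_(`]a, +oo[ : set R) w.1 * \1_(`[0, rho] : set R) w.2 *
   plackett_kernel b w.1 w.2)%:E.

Let measurable_K : measurable_fun setT K.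
Proof.
apply/measurable_EFinP; apply: measurable_funM.
  apply: measurable_funM.
    exact: (measurableT_comp (measurable_indic (measurable_itv _)) (@measurable_fst _ _ _ _)).
  exact: (measurableT_comp (measurable_indic (measurable_itv _)) (@measurable_snd _ _ _ _)).
apply: measurable_funM.
  apply: measurable_funM.
    exact: (measurableT_comp (measurable_normal_pdf _ _) (@measurable_fst _ _ _ _)).
  apply: (measurableT_comp (measurable_normal_pdf _ _)).
  exact: measurable_thr.
by apply: measurableT_comp => //; exact: measurable_dthr.
Qed.

Let K_ge0 w : (0 <= K w)%E.
Proof.
rewrite lee_fin /= !indicE; case: (boolP (w.1 \in _)) => [|_]; last by rewrite !mul0r.
case: (boolP (w.2 \in _)) => [|_]; last by rewrite mulr0 mul0r.
rewrite !inE/= mul1r mul1r => w2 w1.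
have wa : a < w.1 by move: w1; rewrite in_itv/= andbT.
rewrite /plackett_kernel !mulr_ge0 ?normal_pdf_ge0// oppr_ge0 ltW//.
apply: (@dthr_lt0 _ _ _ rho) => //.
  exact: le_lt_trans wa.
exact: le_lt_trans wa.
Qed.

(** The mass that the slice of the quadrant at z gains when the correlation goes from 0 to rho. *)
Let integral_K_snd z : a < z ->
  (\int[mu]_u K (z, u) = (phi z)%:E * gamma `[thr b z rho, b])%E.
Proof.
move=> az; have z0 : 0 < z by exact: le_lt_trans az.
have bz : b < z by exact: le_lt_trans az.
have E u : K (z, u) = ((phi z)%:E * (\1_(`[0, rho] : set R) u * (phi (thr b z u) * - dthr b z u))%:E)%E.
  rewrite /K /plackett_kernel/= -EFinM; congr EFin.
  rewrite indicE mem_set/=; last by rewrite in_itv/= az.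
  by rewrite mul1r; ring.
under eq_integral do rewrite E.
have mm : measurable_fun setT (fun u => phi (thr b z u) * - dthr b z u).
  apply: measurable_funM.
    by apply: (measurableT_comp (measurable_normal_pdf _ _)); exact: measurable_thr.
  by apply: measurableT_comp => //; exact: measurable_dthr.
rewrite ge0_integralZl//; first last.
- by rewrite lee_fin normal_pdf_ge0.
- move=> u _; rewrite lee_fin indicE; case: (boolP (u \in _)) => [|_]; last by rewrite mul0r.
  rewrite inE => /= u0; rewrite mul1r mulr_ge0 ?normal_pdf_ge0// oppr_ge0 ltW//.
  exact: (@dthr_lt0 _ _ _ rho).
- by apply/measurable_EFinP; apply: measurable_funM.
congr (_ * _)%E.
rewrite /normal_prob integral_thr//; last by apply: continuous_normal_pdf.
rewrite [RHS]integral_mkcond; apply: eq_integral => u _.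
rewrite patchE indicE; case: ifP => _; by rewrite ?mul1r ?mul0r.
Qed.

Let integral_K_fst u : u \in `[0, rho] ->
  (\int[mu]_z K (z, u) = ((2 * pi)^-1 * expR (- (a ^+ 2 / 2)))%:E *
   ((Num.sqrt (1 - u ^+ 2))^-1 *
    expR (- ((b - a * u) ^+ 2 / (2 * (1 - u ^+ 2)))))%:E)%E.
Proof.
move=> u0; move: (u0); rewrite in_itv/= => /andP[u1 ur].
have := rho1; have := a0; have := ba => *.
rewrite -integral_normal_pdf_thr; first last.
- have [b0|b0] := leP 0 b; first by rewrite (le_trans _ ba)// ler_piMl//; lra.
  by rewrite (le_trans _ a0)// mulr_ge0_le0// ltW.
- by apply/andP; split; lra.
rewrite [RHS]integral_mkcond; apply: eq_integral => z _.
rewrite patchE /K /= /plackett_kernel [\1_(`[0, rho]%classic : set R) u]indicE mem_set//= mulr1 indicE.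
by case: ifP => _; rewrite ?mul1r ?mul0r.
Qed.

(** The slice starts at [thr b z rho], below b. Cutting at b separates the slice for correlation 0
    from the gain; closing the left endpoint adds a null set. *)
Let xsection_orthant z : a < z ->
  (gamma (xsection (orthant a b rho) z) =
   gamma `]b, +oo[ + gamma `[thr b z rho, b])%E.
Proof.
move=> az.
have s0 : 0 < Num.sqrt (1 - rho ^+ 2).
  by rewrite sqrtr_gt0 onem_sqr_gt0// rho1 andbT (lt_le_trans _ rho0).
have thrb : thr b z rho <= b.
  have ir : rho \in `[0, rho] by rewrite in_itv/= rho0 lexx.
  have i0 : 0 \in `[0, rho] by rewrite in_itv/= rho0 lexx.
  have [->|rn0] := eqVneq rho 0; first by rewrite thr0.
  rewrite -[leRHS](thr0 b z) ltW// (@thr_decreasing _ b z rho)//.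
  - exact: le_lt_trans az.
  - exact: le_lt_trans az.
  - by rewrite lt_neqAle eq_sym rn0.
have -> : xsection (orthant a b rho) z = `]thr b z rho, +oo[%classic.
  have E y : (thr b z rho < y) = (b < rho * z + Num.sqrt (1 - rho ^+ 2) * y).
    by rewrite /thr ltr_pdivrMr// ltrBlDl (mulrC y).
  apply/seteqP; split => y; rewrite /= in_itv/= andbT E /xsection/= inE.
    by case.
  by split.
rewrite (_ : `]thr b z rho, +oo[%classic = `]thr b z rho, b] `|` `]b, +oo[); last first.
  apply/seteqP; split => y /=; rewrite !in_itv/= !andbT.
    by move=> ->/=; have [yb|by'] := leP y b; [left|right].
  by move=> [/andP[]//|]; exact: le_lt_trans.
rewrite measureU//; last first.
  apply/seteqP; split => // y [] /=; rewrite !in_itv/= andbT => /andP[_ yb].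
  by rewrite ltNge yb.
rewrite addeC; congr (_ + _)%E.
transitivity (gamma `]thr b z rho, b]); first by [].
rewrite /normal_prob integral_itv_obnd_cbnd//.
by apply/measurable_funTS/measurable_EFinP; exact: measurable_normal_pdf.
Qed.

Lemma measurable_orthant (a' b' r : R) :
  measurable (orthant a' b' r).
Proof.
have -> : orthant a' b' r =
    [set w | a' < w.1] `&` [set w | b' < (correl r w).2] by [].
apply: measurableI.
  rewrite -[X in measurable X]setTI.
  have -> : [set w : R * R | a' < w.1] = fst @^-1` `]a', +oo[%classic.
    by apply/seteqP; split => w /=; rewrite in_itv/= andbT.
  exact: measurable_fst.
rewrite -[X in measurable X]setTI.
have -> : [set w : R * R | b' < (correl r w).2] = (snd \o correl r) @^-1` `]b', +oo[%classic.
  by apply/seteqP; split => w /=; rewrite in_itv/= andbT.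
have : measurable_fun setT (snd \o correl r) by apply: measurable_linear.
by apply; [exact: measurableT|exact: measurable_itv].
Qed.

Lemma orthant_probability :
  (gamma2 (orthant a b rho) =
   gamma `]a, +oo[ * gamma `]b, +oo[ +
   ((2 * pi)^-1 * expR (- (a ^+ 2 / 2)))%:E * plackett_integral a b rho)%E.
Proof.
have mO := measurable_orthant a b rho.
have mS : measurable_fun setT (gamma \o xsection (orthant a b rho)).
  exact: measurable_fun_xsection.
rewrite {1}/product_measure1.
rewrite ge0_integral_normal_prob//.
(* The contribution of independent variables; it integrates to the product of the two tails. *)
pose A z : \bar R := ((\1_(`]a, +oo[ : set R) z * phi z)%:E * gamma `]b, +oo[)%E.
have E z : ((gamma \o xsection (orthant a b rho)) z * (phi z)%:E =
    A z + \int[mu]_u K (z, u))%E.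
  rewrite /A indicE; have [az|za] := ltP a z.
    rewrite mem_set/=; last by rewrite in_itv/= az.
    rewrite mul1r xsection_orthant// integral_K_snd// muleC.
    by rewrite ge0_muleDr.
  rewrite memNset/=; last by rewrite in_itv/= ltNge za.
  rewrite mul0r mul0e add0e (_ : xsection _ _ = set0); last first.
    by apply/seteqP; split => // y; rewrite /xsection/= inE => -[]; rewrite ltNge za.
  rewrite measure0 mul0e integral0_eq// => u _.
  by rewrite /K/= indicE memNset/= ?mul0r// in_itv/= ltNge za.
under eq_integral do rewrite E.
rewrite ge0_integralD//; first last.
- exact: (@measurable_fun_fubini_tonelli_F _ _ _ _ _ mu K measurable_K K_ge0).
- by move=> z _; apply: integral_ge0.
- apply: emeasurable_funM => //; apply/measurable_EFinP; apply: measurable_funM => //.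
  exact: measurable_normal_pdf.
- by move=> z _; rewrite /A mule_ge0// lee_fin mulr_ge0// normal_pdf_ge0.
congr (_ + _)%E.
  rewrite /A ge0_integralZr//; first last.
  - by move=> z _; rewrite lee_fin mulr_ge0// normal_pdf_ge0.
  - by apply/measurable_EFinP; apply: measurable_funM => //; exact: measurable_normal_pdf.
  congr (_ * _)%E; rewrite [RHS]/normal_prob [RHS]integral_mkcond.
  apply: eq_integral => z _; rewrite patchE indicE.
  by case: ifP => _; rewrite ?mul1r ?mul0r.
rewrite (@fubini_tonelli _ _ _ _ _ mu mu _ measurable_K K_ge0).
rewrite /plackett_integral -ge0_integralZl//; first last.
- by rewrite lee_fin mulr_ge0 ?expR_ge0// invr_ge0 mulr_ge0// pi_ge0.
- apply/measurable_EFinP; apply: measurable_funS (measurable_plackett a b) => //.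
  by move=> u /=; rewrite !in_itv/= => /andP[-> /le_lt_trans/(_ rho1)/ltW].
rewrite [RHS]integral_mkcond; apply: eq_integral => u _.
rewrite patchE; case: ifPn => [|] u0.
  by rewrite integral_K_fst//; move: u0; rewrite inE.
rewrite integral0_eq// => z _; rewrite /K /= [\1_(`[0, rho]%classic : set R) u]indicE (negbTE u0).
by rewrite mulr0 mul0r.
Qed.

End plackett.

(** * Covariances of indicators and their symmetries *)

Section indicator_covariance.
Context {R : realType}.
Local Notation gamma := (normal_prob (0 : R) 1).
Local Notation gamma2 := (gamma \x gamma)%E.
Implicit Types (U V : set R) (rho : R).

Definition joint rho U V : R := fine (gamma2 (correl rho @^-1` (U `*` V))).

Lemma measurable_correl_preimage rho (B : set (R * R)) : measurable B ->
  measurable (correl rho @^-1` B).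
Proof.
by move=> mB; rewrite -[X in measurable X]setTI; exact: measurable_correl.
Qed.

Lemma gamma2_fin_num (B : set (R * R)) : measurable B -> gamma2 B \is a fin_num.
Proof.
move=> mB; rewrite ge0_fin_numE//; apply: (@le_lt_trans _ _ (gamma2 setT)).
  by apply: le_measure; rewrite ?inE.
have -> : gamma2 setT = 1%E; last by rewrite ltry.
rewrite -setXTT product_measure1E// -[RHS]mule1; congr (_ * _)%E;
  exact: (probability_setT gamma).
Qed.

Lemma gamma2_le (A B : set (R * R)) : measurable A -> measurable B ->
  A `<=` B -> fine (gamma2 A) <= fine (gamma2 B).
Proof.
move=> mA mB AB; apply: fine_le; [exact: gamma2_fin_num|exact: gamma2_fin_num|].
by apply: le_measure; rewrite ?inE.
Qed.

Lemma linear_growth_indic U : measurable U -> linear_growth (\1_U : R -> R).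
Proof.
move=> mU; split; first exact: measurable_indic.
exists 1 => x; rewrite mul1r indicE ger0_norm//.
by rewrite (@le_trans _ _ 1)// ?lerDl//; case: (_ \in _).
Qed.

Lemma dotp_indic rho U V : measurable U -> measurable V ->
  dotp rho \1_U \1_V = joint rho U V.
Proof.
move=> mU mV; rewrite /dotp /joint /Rintegral; congr fine.
have mB : measurable (U `*` V) by exact: measurableX.
have mC := measurable_correl_preimage rho mB.
transitivity (\int[gamma2]_w (\1_(correl rho @^-1` (U `*` V)) w)%:E)%E; last first.
  by have /= -> := integral_indic gamma2 measurableT mC; rewrite setIT.
apply: eq_integral => w _; rewrite !indicE -natrM mulnb; congr (_%:R%:E).
by congr nat_of_bool; rewrite -in_setX.
Qed.

(** The exchanged pair is again given by unit coefficient vectors with inner product rho, so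
    [gamma2_linear] identifies its law. *)
Lemma jointC rho U V : 0 <= rho <= 1 -> measurable U -> measurable V ->
  joint rho U V = joint rho V U.
Proof.
move=> /andP[r0 r1] mU mV; rewrite /joint.
have mB : measurable (V `*` U) by exact: measurableX.
have s2 : Num.sqrt (1 - rho ^+ 2) ^+ 2 = 1 - rho ^+ 2.
  by rewrite sqr_sqrtr// subr_ge0 exprn_ile1.
have h1 : rho ^+ 2 + Num.sqrt (1 - rho ^+ 2) ^+ 2 = 1 by rewrite s2; ring.
have h2 : 1 ^+ 2 + 0 ^+ 2 = 1 :> R by ring.
have h3 : rho * 1 + Num.sqrt (1 - rho ^+ 2) * 0 = rho by ring.
have := gamma2_linear h1 h2 h3 mB => <-.
have -> : correl rho @^-1` (U `*` V) =
  [set w | (V `*` U) (rho * w.1 + Num.sqrt (1 - rho ^+ 2) * w.2, 1 * w.1 + 0 * w.2)].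
  by apply/seteqP; split => w /=; rewrite mul1r mul0r addr0 /setX/= => -[].
reflexivity.
Qed.

(** Negating both coefficient vectors preserves their norms and inner product. *)
Lemma joint_opp rho U V : 0 <= rho <= 1 -> measurable U -> measurable V ->
  joint rho (-%R @^-1` U) (-%R @^-1` V) = joint rho U V.
Proof.
move=> /andP[r0 r1] mU mV; rewrite /joint.
have mB : measurable (U `*` V) by exact: measurableX.
have s2 : Num.sqrt (1 - rho ^+ 2) ^+ 2 = 1 - rho ^+ 2.
  by rewrite sqr_sqrtr// subr_ge0 exprn_ile1.
have h1 : (-1) ^+ 2 + 0 ^+ 2 = 1 :> R by ring.
have h2 : (- rho) ^+ 2 + (- Num.sqrt (1 - rho ^+ 2)) ^+ 2 = 1 by rewrite !sqrrN s2; ring.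
have h3 : (-1) * (- rho) + 0 * (- Num.sqrt (1 - rho ^+ 2)) = rho by ring.
have := gamma2_linear h1 h2 h3 mB => <-.
have -> : correl rho @^-1` ((-%R @^-1` U) `*` (-%R @^-1` V)) =
  [set w | (U `*` V) (-1 * w.1 + 0 * w.2, - rho * w.1 + (- Num.sqrt (1 - rho ^+ 2)) * w.2)].
  by apply/seteqP; split => w /=; rewrite mulN1r mul0r addr0 /setX/= !mulNr opprD.
reflexivity.
Qed.

Lemma joint_marginal rho U : measurable U -> joint rho U setT = fine (gamma U).
Proof.
move=> mU; rewrite /joint; congr fine.
have -> : correl rho @^-1` (U `*` setT) = U `*` setT.
  by apply/seteqP; split => w.
rewrite product_measure1E// -[RHS]mule1; congr (_ * _)%E.
exact: (probability_setT gamma).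
Qed.

Section covariance.
Variable rho : R.
Hypothesis rho01 : 0 <= rho <= 1.

Lemma cov_indicE U V : measurable U -> measurable V ->
  cov rho \1_U \1_V = joint rho U V - fine (gamma U) * fine (gamma V).
Proof.
move=> mU mV; have c1 : cst 1 = \1_[set: R] :> (R -> R).
  by apply/funext => x; rewrite indicT.
rewrite /cov c1 !dotp_indic// joint_marginal// (jointC rho01 measurableT)//.
by rewrite joint_marginal.
Qed.

Lemma cov_indicC U V : measurable U -> measurable V ->
  cov rho \1_U \1_V = cov rho \1_V \1_U.
Proof. by move=> mU mV; rewrite !cov_indicE// jointC// [_ * fine (gamma U)]mulrC. Qed.

Lemma cov_indic_opp U V : measurable U -> measurable V ->
  measurable (-%R @^-1` U) -> measurable (-%R @^-1` V) ->
  cov rho \1_(-%R @^-1` U) \1_(-%R @^-1` V) = cov rho \1_U \1_V.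
Proof.
move=> mU mV mU' mV'; rewrite !cov_indicE// joint_opp//.
(* Symmetry of [gamma] is [joint_opp] with the whole line as second set. *)
have e (W : set R) : measurable W -> measurable (-%R @^-1` W) ->
    fine (gamma (-%R @^-1` W)) = fine (gamma W).
  move=> mW mW'; apply: etrans (esym (joint_marginal rho mW')) _.
  exact: etrans (joint_opp rho01 mW measurableT) (joint_marginal rho mW).
by rewrite !e.
Qed.

Lemma cov_cst1l G : linear_growth G -> cov rho (cst 1) G = 0.
Proof.
move=> gG; have c1 : cst 1 = \1_[set: R] :> (R -> R).
  by apply/funext => x; rewrite indicT.
rewrite /cov {2 3}c1 dotp_indic// joint_marginal//.
have -> : fine (gamma [set: R]) = 1 by exact: (congr1 fine (probability_setT gamma)).
by rewrite mul1r subrr.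
Qed.

Lemma cov_cst1r F : linear_growth F -> cov rho F (cst 1) = 0.
Proof.
move=> gF; have c1 : cst 1 = \1_[set: R] :> (R -> R).
  by apply/funext => x; rewrite indicT.
rewrite /cov {3 4}c1 dotp_indic// joint_marginal//.
have -> : fine (gamma [set: R]) = 1 by exact: (congr1 fine (probability_setT gamma)).
by rewrite mulr1 subrr.
Qed.

(** Each indicator becomes 1 minus itself: constants have zero covariance with everything, and the
    two signs cancel. *)
Lemma cov_indic_setC U V : measurable U -> measurable V ->
  cov rho \1_(~` U) \1_(~` V) = cov rho \1_U \1_V.
Proof.
move=> mU mV.
have gU := linear_growth_indic mU; have gV := linear_growth_indic mV.
have gU' := linear_growthZ (-1) gU; have gV' := linear_growthZ (-1) gV.
have g1 := linear_growth_cst (1 : R).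
have E W : \1_(~` W) = cst 1 \+ (fun x => -1 * \1_W x) :> (R -> R).
  by apply/funext => x; rewrite /= !indicE in_setC; case: (_ \in _); rewrite /=; ring.
rewrite !E covDl//; last exact: linear_growthD.
rewrite cov_cst1l; last exact: linear_growthD.
rewrite covDr// cov_cst1r// covZl// covZr//; ring.
Qed.

(** Enlarging by null sets fixes the marginals and cannot decrease the joint probability. It serves
    to pass from open to closed half-lines. *)
Lemma cov_indic_le U V U' V' : measurable U -> measurable V ->
  measurable U' -> measurable V' -> U `<=` U' -> V `<=` V' ->
  gamma U = gamma U' -> gamma V = gamma V' ->
  cov rho \1_U \1_V <= cov rho \1_U' \1_V'.
Proof.
move=> mU mV mU' mV' UU' VV' eU eV; rewrite !cov_indicE// eU eV lerD2r.
apply: gamma2_le.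
- by apply: measurable_correl_preimage; exact: measurableX.
- by apply: measurable_correl_preimage; exact: measurableX.
- by move=> w [/UU' ? /VV' ?].
Qed.

End covariance.
End indicator_covariance.

(** * Plackett's inequality for all half-lines and all rho in [0, 1] *)

Section plackett_inequality.
Context {R : realType}.
Local Notation mu := (@lebesgue_measure R).
Local Notation gamma := (normal_prob (0 : R) 1).
Local Notation gamma2 := (gamma \x gamma)%E.
Local Notation phi := (normal_pdf (0 : R) 1).
Implicit Types a b u rho : R.

Definition binormal_pdf a b u : R := (2 * pi)^-1 * expR (- (a ^+ 2 / 2)) *
  ((Num.sqrt (1 - u ^+ 2))^-1 *
   expR (- ((b - a * u) ^+ 2 / (2 * (1 - u ^+ 2))))).

Lemma binormal_pdf_ge0 a b u : 0 <= binormal_pdf a b u.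
Proof.
by rewrite !mulr_ge0 ?expR_ge0// invr_ge0 ?sqrtr_ge0// mulr_ge0// pi_ge0.
Qed.

(* At u = 1 both sides are 0, since there 0^-1 = 0. *)
Lemma binormal_pdfC a b u : 0 <= u <= 1 -> binormal_pdf a b u = binormal_pdf b a u.
Proof.
move=> /andP[u0]; rewrite le_eqVlt => /predU1P[->|u1].
  by rewrite /binormal_pdf expr1n subrr sqrtr0 invr0 !mul0r !mulr0.
have u11 : -1 < u < 1 by rewrite u1 andbT; lra.
have E x y : binormal_pdf x y u = phi x * phi (thr y x u) / Num.sqrt (1 - u ^+ 2).
  by rewrite normal_pdf_thr// /binormal_pdf; ring.
by rewrite !E normal_pdf_thrC.
Qed.

Lemma binormal_pdfN a b u : binormal_pdf (- a) (- b) u = binormal_pdf a b u.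
Proof.
by rewrite /binormal_pdf sqrrN mulNr opprK (_ : - b + a * u = - (b - a * u)) ?sqrrN//; ring.
Qed.

Lemma measurable_binormal_pdf a b :
  measurable_fun (`[0, 1] : set R) (EFin \o binormal_pdf a b).
Proof.
apply/measurable_EFinP; apply: measurable_funM => //; exact: measurable_plackett.
Qed.

Lemma plackett_integralE a b rho : 0 <= rho <= 1 ->
  (((2 * pi)^-1 * expR (- (a ^+ 2 / 2)))%:E * plackett_integral a b rho =
   \int[mu]_(u in `[0%R, rho]) (binormal_pdf a b u)%:E)%E.
Proof.
move=> /andP[r0 r1]; have c0 : 0 <= (2 * pi)^-1 * expR (- (a ^+ 2 / 2)).
  by rewrite mulr_ge0 ?expR_ge0// invr_ge0 mulr_ge0// pi_ge0.
rewrite /plackett_integral -ge0_integralZl//.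
- apply/measurable_EFinP; apply: measurable_funS (measurable_plackett a b) => //.
  by move=> u /=; rewrite !in_itv/= => /andP[-> /le_trans ->].
Qed.

Lemma gamma_itvcy c a : gamma [set` Interval (BSide c a) +oo%O] = gamma `]a, +oo[.
Proof.
case: c => //; rewrite /normal_prob integral_itv_obnd_cbnd//.
by apply/measurable_funTS/measurable_EFinP; exact: measurable_normal_pdf.
Qed.

Lemma subset_up c a : `]a, +oo[%classic `<=` [set` Interval (BSide c a) +oo%O].
Proof. by move=> x; rewrite /= !in_itv/= !andbT; case: c => //=; exact: ltW. Qed.

Local Notation up a := (\1_(`]a, +oo[%classic : set R) : R -> R).

Lemma cov_up_eq a b rho : 0 <= a -> b <= a -> 0 <= rho -> rho < 1 ->
  (\int[mu]_(u in `[0%R, rho]) (binormal_pdf a b u)%:E =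
   (cov rho (up a) (up b))%:E)%E.
Proof.
move=> a0 ba r0 r1; have r01 : 0 <= rho <= 1 by rewrite r0 ltW.
have := orthant_probability a0 ba r0 r1; rewrite plackett_integralE//.
set I := (\int[_]_(u in _) _)%E => h.
rewrite cov_indicE//.
have -> : joint rho `]a, +oo[ `]b, +oo[ = fine (gamma2 (orthant a b rho)).
  rewrite /joint (_ : correl rho @^-1` _ = orthant a b rho)//.
  by apply/seteqP; split => w; rewrite /setX /orthant /= !in_itv/= !andbT => -[].
have f2 : gamma2 (orthant a b rho) \is a fin_num.
  exact: gamma2_fin_num (measurable_orthant a b rho).
have fg x : gamma `]x, +oo[ \is a fin_num by exact: fin_num_measure.
rewrite EFinB EFinM !fineK// h addeAC subee ?add0e//.
by rewrite fin_numM.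
Qed.

(* Negating both variables and taking complements turns ]-a, +oo[ into [a, +oo[,
   which differs from ]a, +oo[ by a null set. *)
Lemma cov_upN_le a b rho : 0 <= rho <= 1 ->
  cov rho (up (- a)) (up (- b)) <= cov rho (up a) (up b).
Proof.
move=> r01.
have N x : -%R @^-1` `]x, +oo[%classic = `]-oo, (- x)[%classic :> set R.
  by apply/seteqP; split => y /=; rewrite !in_itv/= andbT ltrNr.
have C x : ~` `]-oo, x[%classic = `[x, +oo[%classic :> set R.
  by apply/seteqP; split => y /=; rewrite !in_itv/= andbT leNgt => /negP.
have mo x : measurable (`]x, +oo[%classic : set R) by exact: measurable_itv.
have mn x : measurable (-%R @^-1` (`]x, +oo[%classic : set R)).
  by rewrite N; exact: measurable_itv.
rewrite -(cov_indic_opp r01 (mo a) (mo b) (mn a) (mn b)) !N.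
rewrite -[leRHS](cov_indic_setC r01) ?C//; try exact: measurable_itv.
apply: cov_indic_le => //; try exact: measurable_itv.
- exact: (@subset_up true).
- exact: (@subset_up true).
- exact/esym/gamma_itvcy.
- exact/esym/gamma_itvcy.
Qed.

Lemma eq_plackett a b a' b' rho : 0 <= rho <= 1 ->
  (forall u, 0 <= u <= 1 -> binormal_pdf a b u = binormal_pdf a' b' u) ->
  (\int[mu]_(u in `[0%R, rho]) (binormal_pdf a b u)%:E =
   \int[mu]_(u in `[0%R, rho]) (binormal_pdf a' b' u)%:E)%E.
Proof.
move=> /andP[r0 r1] E; apply: eq_integral => u; rewrite inE/= in_itv/= => /andP[u0 ur].
by rewrite E// u0 (le_trans ur).
Qed.

Lemma cov_up_ge_lt1 a b rho : 0 <= rho -> rho < 1 ->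
  (\int[mu]_(u in `[0%R, rho]) (binormal_pdf a b u)%:E <=
   (cov rho (up a) (up b))%:E)%E.
Proof.
move=> r0 r1; have r01 : 0 <= rho <= 1 by rewrite r0 ltW.
have main x y : 0 <= Num.max x y ->
    (\int[mu]_(u in `[0%R, rho]) (binormal_pdf x y u)%:E =
     (cov rho (up x) (up y))%:E)%E.
  have [xy y0|yx x0] := leP x y; last by rewrite cov_up_eq// ltW.
  rewrite cov_indicC//; try exact: measurable_itv.
  have <- := cov_up_eq y0 xy r0 r1.
  by apply: eq_plackett => // u u01; exact: binormal_pdfC.
have [ab|ab] := leP 0 (Num.max a b); first by rewrite main.
(* Both thresholds are negative here, so their opposites fall under [main]. *)
have nab : 0 <= Num.max (- a) (- b).
  by move: ab; rewrite gt_max le_max !oppr_ge0 => /andP[/ltW -> _].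
apply: (@le_trans _ _ (cov rho (up (- a)) (up (- b)))%:E)%E; last first.
  by rewrite lee_fin; exact: cov_upN_le.
have <- := main _ _ nab.
have eN u : 0 <= u <= 1 -> binormal_pdf a b u = binormal_pdf (- a) (- b) u.
  by rewrite binormal_pdfN.
rewrite (eq_plackett r01 eN); exact: lexx.
Qed.

(* For rho = 1 both variables coincide, so P(Z > a, Y > b) attains its upper bound
   min (P(Z > a), P(Y > b)). The case rho = 1 of [cov_up_ge] is then the limit of
   the cases rho < 1, without any continuity of the left-hand side. *)
Lemma cov_up_le1 a b rho : 0 <= rho <= 1 ->
  cov rho (up a) (up b) <= cov 1 (up a) (up b).
Proof.
move=> r01; have o01 : 0 <= (1 : R) <= 1 by rewrite ler01 lexx.
have mo x : measurable (`]x, +oo[%classic : set R) by exact: measurable_itv.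
rewrite (cov_indicE r01 (mo a) (mo b)) (cov_indicE o01 (mo a) (mo b)) lerD2r.
have key r U V : 0 <= r <= 1 -> measurable U -> measurable V ->
    joint r U V <= fine (gamma U) /\ joint r U V <= fine (gamma V).
  move=> r01' mU mV.
  have le1 W W' : measurable W -> measurable W' -> joint r W W' <= fine (gamma W).
    move=> mW mW'; rewrite -(joint_marginal r mW); apply: gamma2_le.
    - by apply: measurable_correl_preimage; exact: measurableX.
    - by apply: measurable_correl_preimage; exact: measurableX.
    - by move=> w [].
  by split; [exact: le1|rewrite jointC//; exact: le1].
have low c x y : c = Num.max x y ->
    fine (gamma `]c, +oo[) <= joint 1 `]x, +oo[ `]y, +oo[.
  move=> cE; rewrite -(joint_marginal 1 (mo c)); apply: gamma2_le.
  - by apply: measurable_correl_preimage; exact: measurableX.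
  - by apply: measurable_correl_preimage; exact: measurableX.
  - move=> w [/= + _]; rewrite /setX/= !in_itv/= !andbT cE gt_max => /andP[xw yw].
    by rewrite mul1r expr1n subrr sqrtr0 mul0r addr0.
apply: le_trans (low (Num.max a b) _ _ erefl).
have [k1 k2] := key rho _ _ r01 (mo a) (mo b).
by have [ab|ab] := leP a b.
Qed.

Lemma cov_up_ge a b rho : 0 <= rho <= 1 ->
  (\int[mu]_(u in `[0%R, rho]) (binormal_pdf a b u)%:E <=
   (cov rho (up a) (up b))%:E)%E.
Proof.
move=> /andP[r0]; rewrite le_eqVlt => /predU1P[->|]; last exact: cov_up_ge_lt1.
have mf : measurable_fun (`[0, 1] : set R) (EFin \o binormal_pdf a b).
  exact: measurable_binormal_pdf.
rewrite -integral_itv_bndo_bndc; last first.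
  by apply: measurable_funS mf => // u; rewrite /= !in_itv/= => /andP[-> /ltW ->].
(* Monotone convergence along these intervals, which exhaust [0, 1[: each integral is at most the
   covariance at correlation 1 - 1/(n+1), hence at most the one at 1. *)
pose F (n : nat) : set R := `[0%R, 1 - n.+1%:R^-1]%classic.
have invn n : 0 < (n.+1%:R : R)^-1 by rewrite invr_gt0.
have Fsub n : F n `<=` `[0, 1].
  move=> u; rewrite /F /= !in_itv/= => /andP[-> h]/=.
  by rewrite (le_trans h)// lerBlDr lerDl ltW.
have UF : `[0%R, 1%R[%classic = \bigcup_n F n.
  apply/seteqP; split => u; rewrite /= in_itv/=.
    move=> /andP[u0 u1]; have [k uk] := ltr_add_invr u1.
    by exists k => //; rewrite /F/= in_itv/= u0 lerBrDr ltW.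
  by move=> [n _]; rewrite /F/= in_itv/= => /andP[-> h]/=; rewrite (le_lt_trans h)// ltrBlDr ltrDl.
have ndF : nondecreasing_seq F.
  move=> m n mn; rewrite subsetEset => u; rewrite /F /= !in_itv/= => /andP[-> h]/=.
  rewrite (le_trans h)// lerD2l lerN2 lef_pV2 ?posrE// ler_nat//.
have mF n : measurable (F n) by exact: measurable_itv.
have := @ge0_nondecreasing_set_cvg_integral _ (measurableTypeR R) R F (EFin \o binormal_pdf a b) mu ndF mF.
rewrite -UF => H.
have {}H := H (fun n => measurable_funS (measurable_itv _) (@Fsub n) mf)
  (fun n x _ => binormal_pdf_ge0 a b x).
rewrite -(cvg_lim _ H)//; apply: lime_le.
  by apply/cvg_ex; eexists; exact: H.
apply: nearW => n.
have h1 : 0 <= 1 - (n.+1%:R : R)^-1.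
  by rewrite subr_ge0 invf_le1// ler1n.
have h2 : 1 - (n.+1%:R : R)^-1 < 1 by rewrite ltrBlDr ltrDl.
apply: le_trans (cov_up_ge_lt1 a b h1 h2) _.
by rewrite lee_fin; apply: cov_up_le1; rewrite h1 ltW.
Qed.

(** All four open or closed combinations are covered, because [step] mixes both kinds of
    half-lines. *)
Lemma plackett_le_cov_indic c d a b rho : 0 <= rho <= 1 ->
  (((2 * pi)^-1 * expR (- (a ^+ 2 / 2)))%:E * plackett_integral a b rho <=
   (cov rho \1_([set` Interval (BSide c a) +oo%O] : set R)
            \1_([set` Interval (BSide d b) +oo%O] : set R))%:E)%E.
Proof.
move=> r01; rewrite plackett_integralE//; apply: le_trans (cov_up_ge a b r01) _.
rewrite lee_fin; apply: cov_indic_le => //; try exact: measurable_itv.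
- exact: subset_up.
- exact: subset_up.
- exact/esym/gamma_itvcy.
- exact/esym/gamma_itvcy.
Qed.

End plackett_inequality.

(** * Jumps of monotone functions *)

Section monotone_jumps.
Context {R : realType}.
Implicit Types (f h : R -> R) (c L v r x : R).

Lemma nondecreasing_left_limit f c : nondecreasing_fun f ->
  [/\ cvg (f @ c^'-), forall x, x < c -> f x <= lim (f @ c^'-) &
      lim (f @ c^'-) <= f c].
Proof.
move=> ndf; have cf : cvg (f @ c^'-).
  apply: nondecreasing_at_left_is_cvgr; first by near=> x => y z _ _; exact: ndf.
  near=> x; exists (f c) => _ /= [y + <-].
  by rewrite in_itv/= => /andP[_ /ltW]; exact: ndf.
split => //.
- move=> x xc; apply: limr_ge => //.
  have := nbhs_left_gt xc; apply: filterS => y /ltW; exact: ndf.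
- apply: limr_le => //.
  have := nbhs_left_lt c; apply: filterS => y /ltW; exact: ndf.
Unshelve. all: by end_near. Qed.

Lemma nondecreasing_right_limit f c : nondecreasing_fun f ->
  [/\ cvg (f @ c^'+), forall x, c < x -> lim (f @ c^'+) <= f x &
      f c <= lim (f @ c^'+)].
Proof.
move=> ndf; have cf : cvg (f @ c^'+).
  apply: nondecreasing_at_right_is_cvgr; first by near=> x => y z _ _; exact: ndf.
  near=> x; exists (f c) => _ /= [y + <-].
  by rewrite in_itv/= => /andP[/ltW + _]; exact: ndf.
split => //.
- move=> x xc; apply: limr_le => //.
  have := nbhs_right_lt xc; apply: filterS => y /ltW; exact: ndf.
- apply: limr_ge => //.
  have := nbhs_right_gt c; apply: filterS => y /ltW; exact: ndf.
Unshelve. all: by end_near. Qed.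

(** Negation passes through [lim] for convergent filters; monotonicity makes both one-sided limits
    exist. *)
Lemma jumpN f c : nondecreasing_fun f -> jump (fun x => - f x) c = - jump f c.
Proof.
move=> ndf; have [cl _ _] := nondecreasing_left_limit c ndf.
have [cr _ _] := nondecreasing_right_limit c ndf.
rewrite /jump opprB.
rewrite (cvg_lim _ (cvgN cr))// (cvg_lim _ (cvgN cl))//.
by rewrite opprK addrC.
Qed.

(* Two indicators, because the value of a monotone function at a jump can be
   anywhere between its one-sided limits. *)
Definition step c L v r : R -> R := fun x =>
  (v - L) * \1_(`[c, +oo[%classic : set R) x + (r - v) * \1_(`]c, +oo[%classic : set R) x.

Lemma step_lt c L v r x : x < c -> step c L v r x = 0.
Proof.
by move=> xc; rewrite /step !indicE !memNset/= ?mulr0 ?addr0// in_itv/= andbT;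
  [rewrite lt_gtF|rewrite leNgt xc].
Qed.

Lemma step_gt c L v r x : c < x -> step c L v r x = r - L.
Proof.
move=> xc; rewrite /step !indicE !mem_set/=.
- by ring.
- by rewrite in_itv/= xc.
- by rewrite in_itv/= ltW.
Qed.

Lemma step_eq c L v r : step c L v r c = v - L.
Proof.
rewrite /step !indicE mem_set/=; last by rewrite in_itv/= lexx.
by rewrite memNset/= ?mulr0 ?addr0 ?mulr1// in_itv/= ltxx.
Qed.

Lemma nondecreasing_step c L v r : L <= v -> v <= r ->
  nondecreasing_fun (step c L v r).
Proof.
move=> Lv vr x y; rewrite le_eqVlt => /predU1P[->//|xy].
have [xc|cx|xc] := ltgtP x c.
- rewrite (step_lt _ _ _ xc); have [yc|cy|->] := ltgtP y c.
  + by rewrite (step_lt _ _ _ yc).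
  + by rewrite (step_gt _ _ _ cy); lra.
  + by rewrite step_eq; lra.
- by rewrite (step_gt _ _ _ cx) (step_gt _ _ _ (lt_trans cx xy)).
- have cy : c < y by rewrite -xc.
  by rewrite xc step_eq (step_gt _ _ _ cy); lra.
Qed.

(** Reaching or crossing c raises h by at least as much as the step. [L] and [r] are mere bounds, so
    no limit of h has to be computed when this is applied. *)
Lemma nondecreasing_sub_step h c L r : nondecreasing_fun h ->
  (forall x, x < c -> h x <= L) -> (forall x, c < x -> r <= h x) ->
  L <= h c -> h c <= r ->
  nondecreasing_fun (fun x => h x - step c L (h c) r x).
Proof.
move=> ndh hL hr Lh hr' x y; rewrite le_eqVlt => /predU1P[->//|xy].
have hxy := ndh _ _ (ltW xy).
have [xc|cx|xc] := ltgtP x c.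
- have := hL _ xc; rewrite (step_lt _ _ _ xc).
  have [yc|cy|->] := ltgtP y c.
  + by rewrite (step_lt _ _ _ yc); lra.
  + by rewrite (step_gt _ _ _ cy); have := hr _ cy; lra.
  + by rewrite step_eq; lra.
- by rewrite (step_gt _ _ _ cx) (step_gt _ _ _ (lt_trans cx xy)); lra.
- rewrite xc step_eq; have cy : c < y by rewrite -xc.
  by rewrite (step_gt _ _ _ cy); have := hr _ cy; lra.
Qed.

Definition jump_step f c : R -> R :=
  step c (lim (f @ c^'-)) (f c) (lim (f @ c^'+)).

(** Steps are removed from left to right: beyond the earlier points the function already treated is
    f minus the constant [S], so at the next point it jumps exactly as f does. *)
Lemma nondecreasing_sub_jump_steps f (a : nat -> R) (k : nat) :
  nondecreasing_fun f -> (forall i, (1 <= i < k)%N -> a i < a i.+1) ->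
  nondecreasing_fun (fun x => f x - \sum_(1 <= i < k.+1) jump_step f (a i) x).
Proof.
move=> ndf; elim: k => [_ x y xy|k ih aS].
  by rewrite !big_geq// !subr0; exact: ndf.
have a_mono i j : (1 <= i)%N -> (i < j <= k.+1)%N -> a i < a j.
  move=> i1; elim: j => // j ihj; rewrite ltnS leq_eqVlt => /andP[/predU1P[<- ik|ij jk]].
    by apply: aS; rewrite i1.
  apply: (@lt_trans _ _ (a j)); first by apply: ihj; rewrite ij ltnW.
  by apply: aS; rewrite jk andbT (leq_trans i1)// ltnW.
have a_lt i : (1 <= i < k.+1)%N -> a i < a k.+1.
  by move=> /andP[i1 ik]; apply: a_mono => //; rewrite ik/=.
pose h x := f x - \sum_(1 <= i < k.+1) jump_step f (a i) x.
have ndh : nondecreasing_fun h.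
  by apply: ih => i /andP[i1 ik]; apply: aS; rewrite i1 ltnW.
pose S := \sum_(1 <= i < k.+1) (lim (f @ (a i)^'+) - lim (f @ (a i)^'-)).
set c := a k.+1.
have [_ fl fl'] := nondecreasing_left_limit c ndf.
have [_ fr fr'] := nondecreasing_right_limit c ndf.
set L := lim (f @ c^'-) in fl fl'; set r := lim (f @ c^'+) in fr fr'.
have hE x : (forall i, (1 <= i < k.+1)%N -> a i < x) -> h x = f x - S.
  move=> ax; rewrite /h; congr (_ - _); apply: eq_big_nat => i ik.
  by rewrite /jump_step step_gt// ax.
have hc : h c = f c - S by apply: hE => i; exact: a_lt.
have h1 x : x < c -> h x <= L - S.
  move=> xc.
  (* A point between x and c that lies beyond all earlier jumps, where h = f - S; monotonicity of h
     carries the bound back to x. *)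
  have [y [xy yc ay]] : exists y, [/\ x <= y, y < c &
      forall i, (1 <= i < k.+1)%N -> a i < y].
    have : exists y, y < c /\ forall i, (1 <= i < k.+1)%N -> a i < y.
      have [k0|k0] := posnP k; first by exists x; split => //; rewrite k0 => -[].
      have akc : a k < c by apply: a_lt; rewrite k0/=.
      exists ((a k + c) / 2); split; first by rewrite midf_lt.
      move=> i /andP[i1]; rewrite ltnS leq_eqVlt => /predU1P[->|ik].
        by rewrite midf_lt.
      rewrite (@lt_trans _ _ (a k)) ?midf_lt// a_mono// ik/=.
      exact: leqnSn.
    move=> [y [yc ay]]; exists (Num.max x y); split.
    - by rewrite le_max lexx.
    - by rewrite gt_max xc.
    - by move=> i ik; rewrite lt_max ay// orbT.
  by rewrite (le_trans (ndh _ _ xy))// hE// lerD2r fl.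
have h2 x : c < x -> r - S <= h x.
  by move=> cx; rewrite hE ?lerD2r ?fr// => i ik; rewrite (lt_trans (a_lt _ ik)).
have := nondecreasing_sub_step ndh h1 h2.
rewrite hc !lerD2r => /(_ fl' fr') H x y xy.
(* [step] depends only on differences of its levels, so the shift by [S] cancels. *)
have eL : f c - S - (L - S) = f c - L by ring.
have er : r - S - (f c - S) = r - f c by ring.
have E z : f z - \sum_(1 <= i < k.+2) jump_step f (a i) z =
    h z - step c (L - S) (f c - S) (r - S) z.
  by rewrite big_nat_recr//= opprD addrA /step eL er.
by rewrite !E; exact: H.
Qed.

End monotone_jumps.

(** * Linear growth of f and g, and the covariance bound from their jumps *)

Section covariance_of_jumps.
Context {R : realType}.
Implicit Types (f g : R -> R).

Lemma lipschitz_bound f (A : set R) : [lipschitz f x | x in A] ->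
  exists2 M, 0 <= M & forall x y, A x -> A y -> `|f x - f y| <= M * `|x - y|.
Proof.
move=> lf.
have [M [M0 hM]] := @filter_ex _ _ _ _ (filterI (nbhs_pinfty_ge (num_real (0 : R))) lf).
by exists M => // x y Ax Ay; exact: (hM (x, y)).
Qed.

Lemma lipschitz_linear_growth f M p (A : set R) : 0 <= M -> A p ->
  (forall x y, A x -> A y -> `|f x - f y| <= M * `|x - y|) ->
  forall x, A x -> `|f x| <= (`|f p| + M * (1 + `|p|)) * (1 + `|x|).
Proof.
move=> M0 Ap hM x Ax.
have h1 := hM _ _ Ax Ap.
have h2 : `|f x| <= `|f p| + `|f x - f p|.
  by rewrite -{1}(subrK (f p) (f x)) addrC ler_normD.
have h3 : M * `|x - p| <= M * (`|x| + `|p|) by rewrite ler_wpM2l// ler_normB.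
have := normr_ge0 x; have := normr_ge0 p; have := normr_ge0 (f p) => a1 a2 a3.
have : 0 <= `|f p| * `|x| by rewrite mulr_ge0.
have : 0 <= M * `|p| * `|x| by rewrite !mulr_ge0.
lra.
Qed.

(** The Lipschitz bounds control f on the two unbounded intervals, through base points p and q
    inside them; between p and q monotonicity gives |f| <= |f p| + |f q|. *)
Lemma linear_growth_piecewise_lipschitz f (k : nat) (a : nat -> R) :
  nondecreasing_fun f \/ nonincreasing_fun f -> piecewise_lipschitz k a f ->
  linear_growth f.
Proof.
move=> mf lf; split.
  case: mf => mf; [exact: nondecreasing_measurable|exact: nonincreasing_measurable].
have [M M0 hM] := lipschitz_bound (lf 0%N isT).
have [N N0 hN] := lipschitz_bound (lf k (leqnn k)).
have [p hp] : exists p : R, (p%:E < knot k a 1)%E.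
  rewrite /knot/=; case: ifP => _; last by exists 0; rewrite ltry.
  by exists (a 1%N - 1); rewrite lte_fin ltrBlDr ltrDl.
have [q hq] : exists q : R, (knot k a k < q%:E)%E.
  rewrite /knot leqnn; case: ifP => _; first by exists 0; rewrite ltNyr.
  by exists (a k + 1); rewrite lte_fin ltrDl.
have lo x : x <= p -> `|f x| <= (`|f p| + M * (1 + `|p|)) * (1 + `|x|).
  move=> xp; apply: (lipschitz_linear_growth M0 _ hM).
    by rewrite /= {1}/knot/= ltNyr.
  by rewrite /= {1}/knot/= ltNyr/= (le_lt_trans _ hp)// lee_fin.
have kE : knot k a k.+1 = +oo%E by rewrite /knot/= ltnn.
have hi x : q <= x -> `|f x| <= (`|f q| + N * (1 + `|q|)) * (1 + `|x|).
  move=> qx; apply: (lipschitz_linear_growth N0 _ hN).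
    by rewrite /= kE ltry andbT.
  by rewrite /= kE ltry andbT (lt_le_trans hq)// lee_fin.
have mid x : p <= x -> x <= q -> `|f x| <= `|f p| + `|f q|.
  move=> px xq.
  have := ler_norm (f p); have := ler_norm (f q).
  have := ler_norm (- f p); have := ler_norm (- f q); rewrite !normrN => h1 h2 h3 h4.
  have := normr_ge0 (f p); have := normr_ge0 (f q) => h5 h6.
  by case: mf => mf; have := mf _ _ px; have := mf _ _ xq => h7 h8;
    rewrite ler_norml; apply/andP; split; lra.
exists ((`|f p| + M * (1 + `|p|)) + (`|f q| + N * (1 + `|q|))) => x.
have P0 : 0 <= M * (1 + `|p|) by rewrite mulr_ge0 ?addr_ge0.
have Q0 : 0 <= N * (1 + `|q|) by rewrite mulr_ge0 ?addr_ge0.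
have x1 : 1 <= 1 + `|x| by rewrite lerDl.
rewrite mulrDl; have [xp|/ltW px] := leP x p.
  by rewrite (le_trans (lo _ xp))// lerDl mulr_ge0 ?addr_ge0.
have [qx|/ltW xq] := leP q x.
  by rewrite (le_trans (hi _ qx))// lerDr mulr_ge0 ?addr_ge0.
have le1 s t : 0 <= s -> 0 <= t -> s <= (s + t) * (1 + `|x|).
  by move=> s0 t0; rewrite (@le_trans _ _ (s + t)) ?lerDl// ler_peMr// addr_ge0.
by rewrite (le_trans (mid _ px xq))// lerD// le1.
Qed.

Lemma linear_growth_step c L v r : linear_growth (@step R c L v r).
Proof.
apply: linear_growthD; apply: linear_growthZ; apply: linear_growth_indic;
  exact: measurable_itv.
Qed.

Lemma linear_growthB f g : linear_growth f -> linear_growth g ->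
  linear_growth (fun x => f x - g x).
Proof.
move=> gf gg; have := linear_growthD gf (linear_growthZ (-1) gg).
by under eq_fun do rewrite /= mulN1r.
Qed.

Variable rho : R.
Hypothesis rho01 : 0 <= rho <= 1.

Definition plackett_term (x y : R) : \bar R :=
  (((2 * pi)^-1 * expR (- (x ^+ 2 / 2)))%:E * plackett_integral x y rho)%E.

Lemma plackett_term_ge0 x y : (0 <= plackett_term x y)%E.
Proof.
apply: mule_ge0; first by rewrite lee_fin mulr_ge0 ?expR_ge0// invr_ge0 mulr_ge0// pi_ge0.
by apply: integral_ge0 => u _; rewrite lee_fin mulr_ge0 ?expR_ge0// invr_ge0.
Qed.

(** Even when the integral is improper, it is dominated by a covariance, which is a real number. *)
Lemma plackett_term_fin_num x y : plackett_term x y \is a fin_num.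
Proof.
rewrite ge0_fin_numE ?plackett_term_ge0//.
exact: le_lt_trans (plackett_le_cov_indic true true x y rho01) (ltry _).
Qed.

(** Bilinearity yields four indicator covariances, each at least [D], with nonnegative weights of
    total (r - L)(r' - L'). *)
Lemma cov_step_ge c L v r c' L' v' r' : L <= v -> v <= r -> L' <= v' -> v' <= r' ->
  (r - L) * (r' - L') * fine (plackett_term c c') <=
  cov rho (step c L v r) (step c' L' v' r').
Proof.
move=> Lv vr Lv' vr'.
set D := fine _.
have hD e e' : D <= cov rho \1_([set` Interval (BSide e c) +oo%O] : set R)
                            \1_([set` Interval (BSide e' c') +oo%O] : set R).
  rewrite -lee_fin fineK ?plackett_term_fin_num//.
  exact: plackett_le_cov_indic.
have gI e x : linear_growth (\1_([set` Interval (BSide e x) +oo%O] : set R) : R -> R).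
  by apply: linear_growth_indic; exact: measurable_itv.
have gZ k e x := linear_growthZ k (gI e x).
rewrite /step covDl//; last exact: linear_growthD.
rewrite !covDr// !covZl// !covZr//.
have := hD true true; have := hD true false; have := hD false true; have := hD false false.
set c1 := cov _ _ _; set c2 := cov _ _ _; set c3 := cov _ _ _; set c4 := cov _ _ _.
move=> h1 h2 h3 h4.
have p1 : 0 <= v - L by rewrite subr_ge0.
have p2 : 0 <= r - v by rewrite subr_ge0.
have p3 : 0 <= v' - L' by rewrite subr_ge0.
have p4 : 0 <= r' - v' by rewrite subr_ge0.
have -> : (r - L) * (r' - L') * D =
  (v - L) * ((v' - L') * D) + (v - L) * ((r' - v') * D) +
  ((r - v) * ((v' - L') * D) + (r - v) * ((r' - v') * D)) by ring.
by rewrite !lerD// !ler_wpM2l.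
Qed.

Lemma cov_jumps_ge f g (k l : nat) (a b : nat -> R) :
  nondecreasing_fun f -> nondecreasing_fun g ->
  linear_growth f -> linear_growth g ->
  (forall i, (1 <= i < k)%N -> a i < a i.+1) ->
  (forall j, (1 <= j < l)%N -> b j < b j.+1) ->
  \sum_(1 <= i < k.+1) \sum_(1 <= j < l.+1)
    jump f (a i) * jump g (b j) * fine (plackett_term (a i) (b j)) <= cov rho f g.
Proof.
move=> ndf ndg gf gg aS bS.
have gj (h : R -> R) (c : R) : linear_growth (jump_step h c).
  by rewrite /jump_step; exact: linear_growth_step.
have gfj := linear_growth_sum k (fun i => gj f (a i)).
have ggj := linear_growth_sum l (fun j => gj g (b j)).
have gfc := linear_growthB gf gfj.
have ggc := linear_growthB gg ggj.
have ndfc := nondecreasing_sub_jump_steps ndf aS.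
have ndgc := nondecreasing_sub_jump_steps ndg bS.
have splitf h hj : h = (fun x => h x - hj x) \+ hj :> (R -> R).
  by apply/funext => x /=; rewrite subrK.
have bounds (h : R -> R) (c : R) : nondecreasing_fun h -> lim (h @ c^'-) <= h c /\ h c <= lim (h @ c^'+).
  move=> ndh; have [_ _ ?] := nondecreasing_left_limit c ndh.
  by have [_ _ ?] := nondecreasing_right_limit c ndh.
have ndj (h : R -> R) (c : R) : nondecreasing_fun h -> nondecreasing_fun (jump_step h c).
  by move=> ndh; have [? ?] := bounds h c ndh; exact: nondecreasing_step.
have -> : cov rho f g = cov rho (fun x => f x - \sum_(1 <= i < k.+1) jump_step f (a i) x) g +
    cov rho (fun x => \sum_(1 <= i < k.+1) jump_step f (a i) x) g.
  by rewrite -covDl// -splitf.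
rewrite -[leLHS]add0r lerD//; first exact: cov_ge0.
rewrite cov_suml//; apply: ler_sum_nat => i _.
have -> : cov rho (jump_step f (a i)) g =
    cov rho (jump_step f (a i)) (fun x => g x - \sum_(1 <= j < l.+1) jump_step g (b j) x) +
    cov rho (jump_step f (a i)) (fun x => \sum_(1 <= j < l.+1) jump_step g (b j) x).
  by rewrite -covDr// -splitf.
rewrite -[leLHS]add0r lerD//; first by apply: cov_ge0 => //; exact: ndj.
rewrite cov_sumr//; apply: ler_sum_nat => j _.
have [? ?] := bounds f (a i) ndf; have [? ?] := bounds g (b j) ndg.
exact: cov_step_ge.
Qed.

End covariance_of_jumps.

(** * Back to expectations under P *)

Section expectations.
Context d (T : measurableType d) (R : realType) (P : probability T R) (rho : R).
Hypothesis rho01 : 0 <= rho <= 1.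
Variables (Z Y : {RV P >-> R}).
Hypothesis ZY_normal : bivariate_normal Z Y 0
  (\matrix_(i < 2, j < 2) (if i == j then 1 else rho)).

Lemma expectation_prod (F G : R -> R) : linear_growth F -> linear_growth G ->
  ('E_P[fun t => (F (Z t) * G (Y t))%R] = (dotp rho F G)%:E)%E.
Proof.
move=> gF gG; have ii := integrable_correl_prod rho01 gF gG.
have mh : measurable_fun setT (fun w : R * R => F w.1 * G w.2).
  apply: measurable_funM.
    exact: (measurableT_comp gF.1 (@measurable_fst _ _ _ _)).
  exact: (measurableT_comp gG.1 (@measurable_snd _ _ _ _)).
rewrite unlock; have -> := integral_bivariate_normal ZY_normal mh ii.
by rewrite /dotp /Rintegral fineK//; exact: integrable_fin_num.
Qed.

Lemma expectation_cov (F G : R -> R) : linear_growth F -> linear_growth G ->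
  ('E_P[fun t => (F (Z t) * G (Y t))%R] -
     'E_P[fun t => F (Z t)] * 'E_P[fun t => G (Y t)] = (cov rho F G)%:E)%E.
Proof.
move=> gF gG; have g1 := linear_growth_cst (1 : R).
have -> : (fun t => F (Z t)) = (fun t => F (Z t) * cst 1 (Y t)).
  by apply/funext => t; rewrite /= mulr1.
have -> : (fun t => G (Y t)) = (fun t => cst 1 (Z t) * G (Y t)).
  by apply/funext => t; rewrite /= mul1r.
by rewrite !expectation_prod.
Qed.

End expectations.

Theorem lemma17 (d : measure_display) (T : measurableType d) (R : realType)
    (P : probability T R) (rho : R) (rho01 : 0 <= rho <= 1)
    (Z Y : {RV P >-> R})
    (ZY_normal : bivariate_normal Z Y 0
       (\matrix_(i < 2, j < 2) (if i == j then 1 else rho)))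
    (k l : nat) (a b : nat -> R)
    (a_incr : forall i : nat, (i <= k)%N -> (knot k a i < knot k a i.+1)%E)
    (b_incr : forall j : nat, (j <= l)%N -> (knot l b j < knot l b j.+1)%E)
    (f g : R -> R)
    (fg_mono : (nondecreasing_fun f /\ nondecreasing_fun g) \/
               (nonincreasing_fun f /\ nonincreasing_fun g))
    (f_lip : piecewise_lipschitz k a f)
    (g_lip : piecewise_lipschitz l b g) :
  ('E_P[fun t => (f (Z t) * g (Y t))%R] -
     'E_P[fun t => f (Z t)] * 'E_P[fun t => g (Y t)] >=
   \sum_(1 <= i < k.+1) \sum_(1 <= j < l.+1)
     (jump f (a i) * jump g (b j) *
      ((2 * pi)^-1 * expR (- (a i ^+ 2 / 2))))%:E *
     \int[lebesgue_measure]_(u in `[0%R, rho])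
       ((Num.sqrt (1 - u ^+ 2))^-1 *
        expR (- ((b j - a i * u) ^+ 2 / (2 * (1 - u ^+ 2)))))%:E)%E.
Proof.
have gf : linear_growth f.
  by apply: (linear_growth_piecewise_lipschitz _ f_lip); case: fg_mono => -[]; [left|right].
have gg : linear_growth g.
  by apply: (linear_growth_piecewise_lipschitz _ g_lip); case: fg_mono => -[]; [left|right].
rewrite (expectation_cov rho01 ZY_normal gf gg).
have incr n (c : nat -> R) :
    (forall i, (i <= n)%N -> (knot n c i < knot n c i.+1)%E) ->
    forall i, (1 <= i < n)%N -> c i < c i.+1.
  move=> h i /andP[i1 i_n]; have := h i (ltnW i_n).
  by rewrite /knot eqn0Ngt i1/= ltnW// i_n lte_fin.
set S := (\sum_(1 <= i < k.+1) _)%E.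
have -> : S = (\sum_(1 <= i < k.+1) \sum_(1 <= j < l.+1)
    jump f (a i) * jump g (b j) * fine (plackett_term rho (a i) (b j)))%:E.
  rewrite /S -sumEFin; apply: eq_bigr => i _; rewrite -sumEFin; apply: eq_bigr => j _.
  by rewrite [RHS]EFinM fineK ?plackett_term_fin_num// EFinM -muleA.
rewrite lee_fin.
have a_lt := incr _ _ a_incr; have b_lt := incr _ _ b_incr.
case: fg_mono => -[mf mg]; first exact: cov_jumps_ge.
(* In the decreasing case both functions are negated: the covariance is unchanged, and both jumps
   change sign, so their product is unchanged too. *)
have ndf : nondecreasing_fun (fun x => -1 * f x).
  by move=> x y /mf; rewrite !mulN1r lerN2.
have ndg : nondecreasing_fun (fun x => -1 * g x).
  by move=> x y /mg; rewrite !mulN1r lerN2.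
have gNf := linear_growthZ (-1) gf; have gNg := linear_growthZ (-1) gg.
have := cov_jumps_ge rho01 ndf ndg gNf gNg a_lt b_lt.
rewrite covZl// covZr// !mulN1r opprK; apply: le_trans.
have jN (h : R -> R) c : nondecreasing_fun (fun x => -1 * h x) ->
    jump h c = - jump (fun x => -1 * h x) c.
  by move=> ndh; rewrite -jumpN//; congr jump; apply/funext => x; rewrite mulN1r opprK.
rewrite le_eqVlt; apply/orP; left; apply/eqP.
apply: eq_bigr => i _; apply: eq_bigr => j _.
by rewrite !(jN f)// !(jN g)// mulrNN.
Qed.
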